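(* Let $p\in\mathbb{N}=\{0,1,2,\dots\}$, $\alpha>0$, and let $\Omega=\{x_1,\dots,x_n\}$ be a set of $n$ distinct points on the real line. Let $\boldsymbol{L}_\varepsilon=[\kappa_\varepsilon(x_i,x_j)]_{i,j=1}^n$ with $\kappa$ a stationary kernel of smoothness order $r\in\{1,2,\dots\}\cup\{\infty\}$, and let $\mathcal{X}_\varepsilon\sim DPP(\alpha\varepsilon^{-p}\boldsymbol{L}_\varepsilon)$. Then, as $\varepsilon\to0$ ($\varepsilon>0$), $\mathcal{X}_\varepsilon$ converges to a limit $\mathcal{X}_\star$ given as follows. If $\frac{p+1}{2}\ge n$ then, for any value of $r$, $\mathcal{X}_\star=\Omega$ with probability one. If $\frac{p+1}{2}\le n$: 1. if $r<\frac{p+1}{2}$, then $\mathcal{X}_\star=\Omega$ with probability one; 2. if $r>\frac{p+1}{2}$, then (a) if $p$ is odd, $\mathcal{X}_\star\sim|DPP|_l(\boldsymbol{V}_{\le l-1}\boldsymbol{V}_{\le l-1}^\top)$ with $l=\frac{p+1}{2}$; (b) if $p$ is even, $\mathcal{X}_\star\sim DPP\big(\tfrac{\alpha}{\tilde w}\boldsymbol{v}_{l+1}\boldsymbol{v}_{l+1}^\top;\boldsymbol{V}_{\le l-1}\big)$ with $l=\frac p2$ and $\tilde w=\big((\boldsymbol{W}_{\le l})^{-1}\big)_{l+1,l+1}$; 3. if $r=\frac{p+1}{2}$, then $\mathcal{X}_\star\sim DPP\big(\alpha f_{2r-1}\boldsymbol{D}^{(2r-1)};\boldsymbol{V}_{\le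 r-1}\big)$.
   Context: Kernel: a positive definite function $\kappa:\mathbb{R}\times\mathbb{R}\to\mathbb{R}$ (the matrix $[\kappa(y_i,y_j)]_{i,j}$ is positive definite for any finitely many distinct points $y_i$). It is stationary if $\kappa(x,y)=f(|x-y|)$ for a function $f$; $f$ is assumed analytic in a neighbourhood of $0$, $f(t)=\sum_{i\ge0}f_it^i$ with $f_i=f^{(i)}(0)/i!$, and $\kappa_\varepsilon(x,y)=f(\varepsilon|x-y|)$. Smoothness order: $r=\min\{r\ge1:f_{2r-1}\neq0\}$, with $r=\infty$ if all odd coefficients vanish. $\boldsymbol{V}_{\le k}=[x_i^{j}]_{1\le i\le n,\,0\le j\le k}\in\mathbb{R}^{n\times(k+1)}$ is the Vandermonde matrix ($\boldsymbol{V}_{\le-1}$ is empty); $\boldsymbol{v}_{l}=(x_1^{l-1},\dots,x_n^{l-1})^\top$ is its $l$-th column. $\boldsymbol{D}^{(s)}=[|x_i-x_j|^s]_{i,j}$. Wronskian: $\boldsymbol{W}_{\le k}=\left[\frac{1}{i!\,j!}\frac{\partial^{i+j}\kappa}{\partial x^i\partial y^j}(0,0)\right]_{i,j=0}^k\in\mathbb{R}^{(k+1)\times(k+1)}$. For $\boldsymbol{L}$ positive semi-definite: $\mathcal{X}\sim DPP(\boldsymbol{L})$ (L-ensemble) means $\mathbf{P}(\mathcal{X}=X)\propto\det\boldsymbol{L}_X$ for all $X\subseteq\Omega$ (with $\det\boldsymbol{L}_\varnothing=1$); $\mathcal{X}\sim|DPP|_m(\boldsymbol{L})$ means $\mathbf{P}(\mathcal{X}=X)\propto\det\boldsymbol{L}_X$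 if $|X|=m$, and $0$ otherwise. Extended L-ensemble: for $\boldsymbol{L}$ symmetric and $\boldsymbol{V}\in\mathbb{R}^{n\times q}$ of full column rank such that $\boldsymbol{x}^\top\boldsymbol{L}\boldsymbol{x}\ge0$ whenever $\boldsymbol{V}^\top\boldsymbol{x}=0$, $\mathcal{X}\sim DPP(\boldsymbol{L};\boldsymbol{V})$ means $\mathbf{P}(\mathcal{X}=X)\propto(-1)^q\det\begin{pmatrix}\boldsymbol{L}_X&\boldsymbol{V}_{X,:}\\(\boldsymbol{V}_{X,:})^\top&\boldsymbol{0}\end{pmatrix}$ for all $X\subseteq\Omega$ (for $q=0$ this is $DPP(\boldsymbol{L})$). $\boldsymbol{L}_X$ is the principal submatrix indexed by $X$ and $\boldsymbol{V}_{X,:}$ the submatrix of rows in $X$. Convergence: $\mathbf{P}(\mathcal{X}_\varepsilon=X)\to\mathbf{P}(\mathcal{X}_\star=X)$ for every $X\subseteq\Omega$. *)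

(* Defs.v *)
From HB Require Import structures.
From mathcomp Require Import all_boot all_order all_algebra.
From mathcomp Require Import all_classical all_reals all_analysis.

Set Implicit Arguments.
Unset Strict Implicit.
Unset Printing Implicit Defensive.

Import Order.TTheory GRing.Theory Num.Theory.
Import numFieldNormedType.Exports.

Local Open Scope classical_set_scope.
Local Open Scope ring_scope.

Section Kernels.
Context {R : realType}.

Definition qform n (A : 'M[R]_n) (u : 'cV[R]_n) : R := (u^T *m A *m u) 0 0.

Definition posdefmx n (A : 'M[R]_n) : Prop :=
  A^T = A /\ forall u : 'cV[R]_n, u != 0 -> 0 < qform A u.

Definition possemidefmx n (A : 'M[R]_n) : Prop :=
  A^T = A /\ forall u : 'cV[R]_n, 0 <= qform A u.

Definition posdef_kernel (kappa : R -> R -> R) : Prop :=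
  forall (m : nat) (y : 'I_m -> R), injective y ->
    posdefmx (\matrix_(i, j) kappa (y i) (y j)).

Definition stationary (kappa : R -> R -> R) (f : R -> R) : Prop :=
  forall x y, kappa x y = f `|x - y|.

Definition taylor_coef (f : R -> R) (i : nat) : R := derive1n i f 0 / i`!%:R.

(* The total operator derive1n has an unspecified value where the derivative does
   not exist; this is harmless here, since a function that agrees near 0 with
   a convergent power series has the coefficients of that series as its Taylor
   coefficients. *)
Definition analytic_at0 (f : R -> R) : Prop :=
  exists2 rho : R, 0 < rho &
    forall t, `|t| < rho ->
      (\sum_(0 <= i < N) taylor_coef f i * t ^+ i) @[N --> \oo] --> f t.

(* None stands for an infinite smoothness order. *)
Definition smoothness_order (f : R -> R) (r : option nat) : Prop :=
  if r is Some k then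
    [/\ (1 <= k)%N, taylor_coef f (2 * k - 1) != 0 &
      forall j : nat, (1 <= j)%N -> taylor_coef f (2 * j - 1) != 0 -> (k <= j)%N]
  else forall j : nat, (1 <= j)%N -> taylor_coef f (2 * j - 1) = 0.

Definition order_ereal (r : option nat) : \bar R :=
  if r is Some k then k%:R%:E else +oo%E.

Definition kernel_mx n (f : R -> R) (x : 'I_n -> R) (eps : R) : 'M[R]_n :=
  \matrix_(i, j) f (eps * `|x i - x j|).

Definition wronskian (kappa : R -> R -> R) (k : nat) : 'M[R]_k.+1 :=
  \matrix_(i, j)
    ((i`!%:R * j`!%:R)^-1 * derive1n i (fun a => derive1n j (kappa a) 0) 0).

(* vander x q has the q columns of exponents 0, ..., q - 1: it is the matrix
   usually written V_{<= q - 1}, and it is empty for q = 0. *)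
Definition vander n (x : 'I_n -> R) (q : nat) : 'M[R]_(n, q) :=
  (Vandermonde q (\row_i x i))^T.

(* Columns are numbered from 1, so that vcol x l has exponent l - 1. *)
Definition vcol n (x : 'I_n -> R) (l : nat) : 'cV[R]_n :=
  \col_i x i ^+ (l - 1).

Definition dist_mx n (x : 'I_n -> R) (s : nat) : 'M[R]_n :=
  \matrix_(i, j) `|x i - x j| ^+ s.

End Kernels.

(* A random subset of the ground set {x_1, ..., x_n} is represented by the law
   of its set of indices. *)
Section PointProcesses.
Context {R : realType} {n : nat}.
Implicit Types (P w : {set 'I_n} -> R) (L : 'M[R]_n).

Definition is_law P : Prop := (forall X, 0 <= P X) /\ \sum_X P X = 1.

Definition law_propto P w : Prop :=
  is_law P /\ exists c : R, forall X, P X = c * w X.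

Definition prin_submx L (X : {set 'I_n}) : 'M[R]_#|X| :=
  mxsub (@enum_val _ (mem X)) (@enum_val _ (mem X)) L.

Definition row_submx q (V : 'M[R]_(n, q)) (X : {set 'I_n}) : 'M[R]_(#|X|, q) :=
  rowsub (@enum_val _ (mem X)) V.

Definition is_DPP P L : Prop :=
  possemidefmx L /\ law_propto P (fun X => \det (prin_submx L X)).

Definition is_fixed_size_DPP P (m : nat) L : Prop :=
  possemidefmx L /\
  law_propto P (fun X => if #|X| == m then \det (prin_submx L X) else 0).

Definition is_extended_DPP P L q (V : 'M[R]_(n, q)) : Prop :=
  [/\ L^T = L,
      \rank V = q,
      forall u : 'cV[R]_n, V^T *m u = 0 -> 0 <= qform L u &
      law_propto P (fun X => (-1) ^+ q *
        \det (block_mx (prin_submx L X) (row_submx V X) (row_submx V X)^T 0))].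

End PointProcesses.

(* Main.v *)
Require Import Defs.
From HB Require Import structures.
From mathcomp Require Import all_boot all_order all_algebra.
From mathcomp Require Import all_classical all_reals all_analysis.
From mathcomp Require Import ring lra zify.

Set Implicit Arguments.
Unset Strict Implicit.
Unset Printing Implicit Defensive.

Import Order.TTheory GRing.Theory Num.Theory.
Import numFieldNormedType.Exports.

Local Open Scope classical_set_scope.
Local Open Scope ring_scope.

(** The weight of a set X of m points is alpha^m eps^(-pm) det f(eps |x_i - x_j|),
    so everything rests on the exact order in eps of these determinants and on
    their leading coefficients ([det_kernel_cvg]). Write f = sum_s c_s t^s, let r
    be the smoothness order and q = min(m, r). Conjugating the kernel matrix by
    the inverse U of the full Vandermonde matrix turns the monomial x^a into the
    a-th basis vector. Dividing row a by eps^min(a, q) and column b by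
    eps^min(b, q - 1) then gives a matrix with a finite limit: even powers of
    |x - y| expand into products x^i y^j with i + j = s, which are never too large
    for this scaling, and the first odd power that occurs is 2q - 1 at the earliest.
    The limit is block triangular, with the Wronskian of size q as first diagonal
    block and the block of c_{2q-1} U D^(2q-1) U^T on the indices at least q as
    second one. The determinant of the second block, times det(U)^(-2), is the
    signed bordered determinant that defines extended L-ensembles
    ([saddle_vander]). The order in eps is the sum over a < m of
    min(a, q) + min(a, q - 1), that is of 2a as long as a < r and of 2r - 1 afterwards.

    The total order of the weight of X therefore depends on m only, and passing
    from m to m + 1 points changes it by 2m - p, respectively by 2r - 1 - p. This
    change is nondecreasing in m, so the sizes of minimal order form an interval
    ([optimal_sizeE]), and only they survive in the limit: all points if every
    change is negative, a single size l if p = 2l - 1 and r > l, the two sizes l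
    and l + 1 if p = 2l and r > l, all sizes at least r if p = 2r - 1. Normalizing
    gives the limit law ([flat_limit]), and comparing the leading coefficients
    with the bordered determinants of the claimed limits gives the cases.

    The normalization requires that no leading coefficient vanishes, and this is
    where positive definiteness of the kernel enters, for configurations other
    than the given one. If the Wronskian had a null vector, a cluster of points
    shrinking to 0 with corresponding coefficients would have vanishing energy,
    hence vanishing interaction with any fixed further point y
    ([wronskian_probe]). This is a linear differential equation for f near 0. It
    contradicts the presence of the odd coefficient c_{2r-1} when r is finite; when
    r is infinite it makes all kernel matrices near 0 of bounded rank, against
    positive definiteness. For the distance matrix, a null vector u orthogonal to
    the polynomials of degree less than r has vanishing interaction with all
    further combinations of that kind. Probing
    with a divided difference that straddles the rightmost node carrying a
    nonzero coefficient detects the kink of |x - y|^(2r-1) there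
    ([distance_form_definite]). *)

(** * Power series and their expansions at a shifted point *)

Section PowerSeries.
Context {R : realType}.
Implicit Types (c : nat -> R) (rho t y tau : R).

Definition converges_within c rho := forall t, `|t| < rho -> cvgn (pseries c t).

Definition psum c t : R := limn (pseries c t).

(** Coefficients of the j-th derivative divided by j!, so that [psum (hasse c j) y]
    is the j-th Taylor coefficient at y. *)
Definition hasse c j : nat -> R := fun i => c (i + j)%N * 'C(i + j, j)%:R.

Lemma binomial_term_le (a b : R) (s j : nat) : 0 <= a -> 0 <= b ->
  'C(s, j)%:R * a ^+ (s - j) * b ^+ j <= (a + b) ^+ s.
Proof.
move=> a0 b0; case: (leqP j s) => [js|sj]; last first.
  by rewrite bin_small// !mul0r exprn_ge0// addr_ge0.
rewrite exprDn (bigD1 (inord j)) //= inordK ?ltnS//.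
rewrite -mulrA mulr_natl lerDl sumr_ge0// => i _.
by rewrite mulrn_wge0// mulr_ge0// exprn_ge0.
Qed.

Lemma abs_series_bounded c rho t : converges_within c rho -> 0 <= t < rho ->
  exists2 C : R, 0 <= C & forall S : nat, \sum_(0 <= s < S) `|c s| * t ^+ s <= C.
Proof.
move=> cvgc /andP[t0 trho]; pose t' := (t + rho) / 2.
have tt' : t < t' by rewrite /t'; lra.
have t'rho : `|t'| < rho by rewrite ger0_norm /t'; lra.
have cv : cvgn (pseries (fun i => `|c i|) t).
  by apply: is_cvg_pseries_inside_norm (cvgc _ t'rho) _; rewrite !ger0_norm// /t'; lra.
have nd : nondecreasing_seq (pseries (fun i => `|c i|) t).
  by apply: nondecreasing_series => i _ _; rewrite mulr_ge0 ?exprn_ge0.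
exists (psum (fun i => `|c i|) t) => [|S].
  by have := nondecreasing_cvgn_le nd cv 0; rewrite /pseries /series/= big_geq.
exact: nondecreasing_cvgn_le nd cv S.
Qed.

(** A derivative loses only a factor (|y| / (|y| + tau))^s: each of its terms, times
    tau^j, is one term of the binomial expansion of (|y| + tau)^(i + j). *)
Lemma hasse_within c rho j : converges_within c rho ->
  converges_within (hasse c j) rho.
Proof.
move=> cvgc y yrho; pose tau := (rho - `|y|) / 2.
have tau0 : 0 < tau by rewrite /tau; lra.
have y0 := normr_ge0 y.
have [|C C0 HC] := @abs_series_bounded c rho (`|y| + tau) cvgc.
  by rewrite /tau; lra.
apply: normed_cvg; apply: nondecreasing_is_cvgn.
  by apply: nondecreasing_series => i _ _; exact: normr_ge0.
exists (C / tau ^+ j) => _ [S _ <-].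
rewrite ler_pdivlMr ?exprn_gt0// mulr_suml.
apply: le_trans (HC (S + j)%N).
rewrite [leRHS](@big_cat_nat _ _ _ j)//= ?leq_addl//.
apply: (@le_trans _ _ (\sum_(j <= i < S + j) `|c i| * (`|y| + tau) ^+ i)); last first.
  by rewrite lerDr sumr_ge0// => i _; rewrite mulr_ge0// exprn_ge0// addr_ge0// ltW.
rewrite -{3}[j]add0n big_addn addnK.
apply: ler_sum_nat => i _.
rewrite /hasse !normrM normrX (ger0_norm (ler0n _ _)) -!mulrA ler_wpM2l//.
have := binomial_term_le (i + j) j y0 (ltW tau0).
by rewrite addnK mulrA.
Qed.

(** With the truncated subtraction s - j the terms with s < j vanish because their
    binomial coefficient does; this lets the series for all j share one index. *)
Lemma hasse_partial c j y S :
  \sum_(0 <= s < S + j) c s * 'C(s, j)%:R * y ^+ (s - j) = pseries (hasse c j) y S.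
Proof.
rewrite (@big_cat_nat _ _ _ j)//= ?leq_addl//.
rewrite big_nat_cond big1 ?add0r; last first.
  by move=> i; rewrite andbT => /andP[_ ij]; rewrite bin_small// mulr0 mul0r.
rewrite -{1}[j]add0n big_addn addnK /pseries /series/=.
by apply: eq_bigr => i _; rewrite addnK.
Qed.

Lemma hasse_cvg c rho j y : converges_within c rho -> `|y| < rho ->
  (\sum_(0 <= s < S) c s * 'C(s, j)%:R * y ^+ (s - j)) @[S --> \oo]
    --> psum (hasse c j) y.
Proof.
move=> cvgc yrho.
rewrite -(cvg_shiftn j) /=.
rewrite (_ : (fun _ => _) = pseries (hasse c j) y); last first.
  by apply/funext => S; rewrite hasse_partial.
exact: (hasse_within cvgc yrho).
Qed.

(** Summing beyond s adds only zeros, and makes it possible to split the expansion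
    at any N without comparing N and s. *)
Lemma binomial_padded (a b : R) (s N : nat) :
  (a + b) ^+ s =
    \sum_(0 <= j < s.+1 + N) 'C(s, j)%:R * a ^+ (s - j) * b ^+ j.
Proof.
rewrite (@big_cat_nat _ _ _ s.+1)//= ?leq_addr//.
rewrite [X in _ = _ + X]big_nat_cond [X in _ = _ + X]big1 ?addr0; last first.
  by move=> i; rewrite andbT => /andP[ij _]; rewrite bin_small// !mul0r.
rewrite exprDn big_mkord; apply: eq_bigr => i _.
by rewrite -mulrA mulr_natl.
Qed.

Lemma binomial_tail_le (a b tau t : R) (s N : nat) : 0 <= a -> 0 < tau ->
  `|t| <= tau -> `|b| <= a ->
  `|(b + t) ^+ s - \sum_(0 <= j < N) 'C(s, j)%:R * b ^+ (s - j) * t ^+ j| <=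
    (`|t| / tau) ^+ N * (a + tau) ^+ s.
Proof.
move=> a0 tau0 tt ba.
rewrite (binomial_padded b t s N) (@big_cat_nat _ _ _ N)//= ?leq_addl// addrC addrK.
apply: (le_trans (ler_norm_sum _ _ _)).
rewrite (binomial_padded a tau s N) (@big_cat_nat _ _ _ N 0 _)//= ?leq_addl// mulrDr.
apply: ler_wpDl.
  rewrite mulr_ge0 ?exprn_ge0 ?divr_ge0// ?(ltW tau0)// sumr_ge0// => i _.
  by rewrite !mulr_ge0// exprn_ge0// ltW.
rewrite mulr_sumr; apply: ler_sum_nat => j /andP[Nj _].
rewrite !normrM !normrX (ger0_norm (ler0n _ _)).
have Ej (v : R) : v ^+ j = v ^+ N * v ^+ (j - N) by rewrite -exprD subnKC.
rewrite [leRHS](_ : _ = 'C(s, j)%:R * a ^+ (s - j) *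
    (`|t| ^+ N * tau ^+ (j - N))); last first.
  rewrite expr_div_n (Ej tau).
  by field; rewrite expf_neq0// gt_eqF.
rewrite -!mulrA ler_wpM2l//; apply: ler_pM; rewrite ?mulr_ge0 ?exprn_ge0//.
  by rewrite lerXn2r// nnegrE ?normr_ge0.
by rewrite Ej ler_wpM2l ?exprn_ge0// lerXn2r// nnegrE ltW.
Qed.

(** The constant does not depend on N: the same estimate gives the convergence of
    the Taylor series at y (N to infinity) and the order of its remainders (t to 0). *)
Lemma taylor_bound c rho y tau : converges_within c rho ->
  0 < tau -> `|y| + tau < rho ->
  exists2 C : R, 0 <= C & forall (t : R) (N : nat), `|t| <= tau ->
    `|psum c (y + t) - \sum_(0 <= j < N) psum (hasse c j) y * t ^+ j| <=
      C * (`|t| / tau) ^+ N.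
Proof.
move=> cvgc tau0 ytau; have y0 := normr_ge0 y.
have [|C C0 HC] := @abs_series_bounded c rho (`|y| + tau) cvgc; first by lra.
exists C => // t N tt.
have ytrho : `|y + t| < rho by rewrite (le_lt_trans (ler_normD _ _))//; lra.
have yrho : `|y| < rho by lra.
pose D S := \sum_(0 <= s < S) c s * ((y + t) ^+ s -
   \sum_(0 <= j < N) 'C(s, j)%:R * y ^+ (s - j) * t ^+ j).
have cD : D S @[S --> \oo] -->
    psum c (y + t) - \sum_(0 <= j < N) psum (hasse c j) y * t ^+ j.
  have -> : D = fun S => pseries c (y + t) S -
     \sum_(0 <= j < N) (\sum_(0 <= s < S) c s * 'C(s, j)%:R * y ^+ (s - j)) * t ^+ j.
    apply/funext => S; rewrite /D /pseries /series/=.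
    under [X in _ = _ - X]eq_bigr do rewrite mulr_suml.
    rewrite exchange_big/= -sumrB; apply: eq_bigr => s _.
    by rewrite mulrBr mulr_sumr; congr (_ - _); apply: eq_bigr => j _; rewrite !mulrA.
  apply: cvgB; first exact: cvgc.
  apply: cvg_big; first exact: add_continuous.
  move=> j _; apply: cvgM; [exact: hasse_cvg cvgc yrho|exact: cvg_cst].
refine (cvgr_to_le (cvg_norm cD) _); near=> S.
apply: (le_trans (ler_norm_sum _ _ _)).
apply: (@le_trans _ _ (\sum_(0 <= s < S) `|c s| * (`|y| + tau) ^+ s * (`|t| / tau) ^+ N)).
  apply: ler_sum => s _; rewrite normrM -mulrA ler_wpM2l// mulrC.
  exact: binomial_tail_le.
by rewrite -mulr_suml ler_wpM2r// exprn_ge0// divr_ge0// ltW.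
Unshelve. all: by end_near. Qed.

Lemma psum0 c : psum c 0 = c 0.
Proof.
apply: cvg_lim => //; rewrite -cvg_shiftS /=.
rewrite (_ : (fun _ => _) = fun=> c 0); first exact: cvg_cst.
apply/funext => S; rewrite /pseries /series/= big_nat_recl// expr0 mulr1.
by rewrite big1 ?addr0// => i _; rewrite expr0n mulr0.
Qed.

Lemma psum_hasse0 c j : psum (hasse c j) 0 = c j.
Proof. by rewrite psum0 /hasse add0n binn mulr1. Qed.

Lemma taylor_series c rho y t : converges_within c rho -> `|y| + `|t| < rho ->
  (\sum_(0 <= j < N) psum (hasse c j) y * t ^+ j) @[N --> \oo] --> psum c (y + t).
Proof.
move=> cvgc yt; pose tau := (`|t| + (rho - `|y|)) / 2.
have t0 := normr_ge0 t.
have tau0 : 0 < tau by rewrite /tau; lra.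
have [|C C0 HC] := @taylor_bound c rho y tau cvgc tau0; first by rewrite /tau; lra.
have ttau : `|t| < tau by rewrite /tau; lra.
apply/subr_cvg0; apply: norm_cvg0.
apply: (@squeeze_cvgr _ _ _ _ (fun=> 0) (fun N => C * (`|t| / tau) ^+ N)).
- near=> N; rewrite normr_ge0/= distrC; apply: HC; exact: ltW.
- exact: cvg_cst.
- rewrite -(mulr0 C); apply: cvgM; first exact: cvg_cst.
  by apply: cvg_expr; rewrite normrM normfV normr_id (gtr0_norm tau0) ltr_pdivrMr ?mul1r.
Unshelve. all: by end_near. Qed.

Lemma cvg_exprS_at_right0 k : (eps ^+ k.+1) @[eps --> (0 : R)^'+] --> (0 : R).
Proof.
have E : (0 : R) ^+ k.+1 = 0 by rewrite expr0n.
apply: cvg_at_right_filter; rewrite -[X in _ --> X]E.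
exact: exprn_continuous.
Qed.

Lemma taylor_at_right c rho y z k N : converges_within c rho -> `|y| < rho ->
  (k < N)%N ->
  ((psum c (y + eps * z) -
      \sum_(0 <= j < N) psum (hasse c j) y * (eps * z) ^+ j) / eps ^+ k)
    @[eps --> 0^'+] --> 0.
Proof.
move=> cvgc yrho kN; pose tau := (rho - `|y|) / 2.
have tau0 : 0 < tau by rewrite /tau; lra.
have [|C C0 HC] := @taylor_bound c rho y tau cvgc tau0; first by rewrite /tau; lra.
apply: norm_cvg0.
apply: (@squeeze_cvgr _ _ _ _ (fun=> 0)
  (fun eps => C * (`|z| / tau) ^+ N * eps ^+ (N - k.+1).+1)).
- near=> eps.
  have eps0 : 0 < eps by near: eps; exact: nbhs_right_gt.
  rewrite normr_ge0/= normrM normfV normrX (gtr0_norm eps0).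
  rewrite ler_pdivrMr ?exprn_gt0//.
  have -> : C * (`|z| / tau) ^+ N * eps ^+ (N - k.+1).+1 * eps ^+ k =
      C * (`|eps * z| / tau) ^+ N.
    rewrite -mulrA -exprD subnSK// subnK 1?ltnW// -mulrA -exprMn.
    by rewrite normrM (gtr0_norm eps0); rewrite [_ * eps]mulrC mulrA.
  apply: HC; rewrite normrM (gtr0_norm eps0).
  have : eps <= tau / (`|z| + 1).
    by near: eps; apply: nbhs_right_le; rewrite divr_gt0// ltr_wpDl.
  rewrite ler_pdivlMr ?ltr_wpDl// => /(le_trans _); apply.
  by rewrite ler_wpM2l ?(ltW eps0)// lerDl.
- exact: cvg_cst.
- rewrite -[X in _ --> X](mulr0 (C * (`|z| / tau) ^+ N)).
  by apply: cvgM; [exact: cvg_cst|exact: cvg_exprS_at_right0].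
Unshelve. all: by end_near. Qed.

Lemma pseries_sum_cvg (I : finType) (w : I -> R) (cs : I -> nat -> R) rho y :
  (forall b, converges_within (cs b) rho) -> `|y| < rho ->
  pseries (fun i => \sum_b w b * cs b i) y @ \oo --> \sum_b w b * psum (cs b) y.
Proof.
move=> cvgs yrho.
rewrite (_ : pseries _ _ = fun S => \sum_b w b * pseries (cs b) y S).
  apply: cvg_big; first exact: add_continuous.
  move=> b _; apply: cvgM; first exact: cvg_cst.
  exact: cvgs yrho.
apply/funext => S; rewrite /pseries /series/=.
under eq_bigr do rewrite mulr_suml.
rewrite exchange_big/=; apply: eq_bigr => b _.
by rewrite !mulr_sumr; apply: eq_bigr => i _; rewrite mulrA.
Qed.

Lemma bin_ratio (s k : nat) :
  'C(s + k, k)%:R = (s + k)`!%:R / (k`!%:R * s`!%:R) :> R.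
Proof.
apply: (canRL (mulfK _)); first by rewrite mulf_neq0// pnatr_eq0 -lt0n fact_gt0.
by rewrite -!natrM -(bin_fact (leq_addl s k)) addnK.
Qed.

Lemma sign_same_parity (a b : nat) : ~~ odd (a + b) -> (-1) ^+ a = (-1) ^+ b :> R.
Proof.
by rewrite -signr_odd -[RHS]signr_odd oddD; do 2 case: odd.
Qed.

Lemma psum_even c t : (forall s, odd s -> c s = 0) -> psum c `|t| = psum c t.
Proof.
move=> codd; congr (lim (_ @ \oo)); apply/funext => S.
apply: eq_bigr => s _ /=; have [/codd->|es] := boolP (odd s); first by rewrite !mul0r.
by rewrite -normrX ger0_norm// exprn_even_ge0.
Qed.

Lemma psum_zero y : psum (fun=> 0) y = 0.
Proof.
apply: cvg_lim => //; rewrite (_ : pseries _ _ = fun=> 0); first exact: cvg_cst.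
by apply/funext => S; rewrite /pseries /series/= big1// => i _; rewrite mul0r.
Qed.

Lemma psum_sum (I : finType) (w : I -> R) (cs : I -> nat -> R) rho y :
  (forall b, converges_within (cs b) rho) -> `|y| < rho ->
  psum (fun i => \sum_b w b * cs b i) y = \sum_b w b * psum (cs b) y.
Proof. by move=> cvgs yrho; apply: cvg_lim => //; exact: pseries_sum_cvg yrho. Qed.

Lemma converges_within_sum (I : finType) (w : I -> R) (cs : I -> nat -> R) rho :
  (forall b, converges_within (cs b) rho) ->
  converges_within (fun i => \sum_b w b * cs b i) rho.
Proof.
by move=> cvgs y yrho; apply/cvg_ex; eexists; exact: pseries_sum_cvg yrho.
Qed.

(** The first coefficient that could differ from 0 is the limit of the sum
    divided by the corresponding power. *)
Lemma psum_identity c rho delta : converges_within c rho -> 0 < delta ->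
  delta <= rho ->
  (forall y, 0 < y < delta -> psum c y = 0) -> forall i, c i = 0.
Proof.
move=> cvgc delta0 drho c0 i; elim/ltn_ind: i => N IH.
have := @taylor_at_right c rho 0 1 N N.+1 cvgc.
rewrite normr0 => /(_ (lt_le_trans delta0 drho) (ltnSn N)) H.
suff : (- c N)  @[eps --> (0 : R)^'+] --> (0 : R).
  move=> h; apply/eqP; rewrite -oppr_eq0; apply/eqP.
  by rewrite -(cvg_lim _ h)//; apply/esym/cvg_lim => //; exact: cvg_cst.
apply: cvg_trans H; apply: near_eq_cvg; near=> eps.
have eps0 : 0 < eps by near: eps; exact: nbhs_right_gt.
rewrite mulr1 add0r c0; last first.
  by rewrite eps0/=; near: eps; exact: nbhs_right_lt.
rewrite big_nat_recr//= big_nat_cond big1 ?add0r; last first.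
  by move=> j; rewrite andbT => /andP[_ /IH cj]; rewrite psum_hasse0 cj mul0r.
by rewrite psum_hasse0 ?add0r mulNr mulfK// expf_neq0// gt_eqF.
Unshelve. all: by end_near. Qed.

End PowerSeries.

(** * Leading terms of combinations of kernel values *)

Section Limits.
Context {R : realType}.

Lemma cvg_det (T : Type) (F : set_system T) (FF : Filter F) m
    (A : T -> 'M[R]_m) (B : 'M[R]_m) :
  (forall i j, A x i j @[x --> F] --> B i j) ->
  \det (A x) @[x --> F] --> \det B.
Proof.
move=> AB; rewrite /determinant.
apply: cvg_big; first exact: add_continuous.
move=> s _; apply: cvgM; first exact: cvg_cst.
by apply: cvg_big => //; exact: mul_continuous.
Qed.

Variables (f : R -> R) (c : nat -> R) (rho : R).
Hypotheses (rho0 : 0 < rho) (cvgc : converges_within c rho)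
  (fE : forall t, `|t| < rho -> f t = psum c t).

Lemma near_small (z e : R) : 0 < e -> \forall eps \near (0 : R)^'+, `|eps * z| < e.
Proof.
move=> e0; near=> eps.
have eps0 : 0 < eps by near: eps; exact: nbhs_right_gt.
rewrite normrM (gtr0_norm eps0).
have : eps < e / (`|z| + 1).
  by near: eps; apply: nbhs_right_lt; rewrite divr_gt0// ltr_wpDl.
rewrite ltr_pdivlMr ?ltr_wpDl// => /(le_lt_trans _); apply.
by rewrite ler_wpM2l ?(ltW eps0)// lerDl.
Unshelve. all: by end_near. Qed.

(** The moments of g against powers of d of order less than k are allowed to be
    nonzero when the matching Taylor coefficient of f vanishes: odd powers of the
    distance are dealt with in this way. *)
Lemma cvg_combination_at (I : finType) (g d : I -> R) (y : R) (k : nat) :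
  `|y| < rho ->
  (forall s, (s < k)%N -> psum (hasse c s) y * \sum_i g i * d i ^+ s = 0) ->
  ((\sum_i g i * f (y + eps * d i)) / eps ^+ k) @[eps --> 0^'+] -->
    psum (hasse c k) y * \sum_i g i * d i ^+ k.
Proof.
move=> yrho van.
pose rem i eps := (psum c (y + eps * d i) -
  \sum_(0 <= j < k.+1) psum (hasse c j) y * (eps * d i) ^+ j) / eps ^+ k.
have H : (\sum_i g i * rem i eps + psum (hasse c k) y * \sum_i g i * d i ^+ k)
    @[eps --> 0^'+] --> psum (hasse c k) y * \sum_i g i * d i ^+ k.
  rewrite -[X in _ --> X]add0r; apply: cvgD; last exact: cvg_cst.
  have Z : \sum_i g i * 0 = 0 by rewrite big1// => i _; rewrite mulr0.
  rewrite -[X in _ --> X]Z.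
  apply: cvg_big; first exact: add_continuous.
  move=> i _; apply: cvgM; first exact: cvg_cst.
  exact: taylor_at_right cvgc _ _.
apply: cvg_trans H; apply: near_eq_cvg; near=> eps.
have eps0 : 0 < eps by near: eps; exact: nbhs_right_gt.
have epsk : eps ^+ k != 0 by rewrite expf_neq0// gt_eqF.
have fi : forall i, `|y + eps * d i| < rho.
  near: eps; apply: filter_forall => i; near=> eps.
  rewrite (le_lt_trans (ler_normD _ _))// -ltrBrDl.
  by near: eps; apply: near_small; rewrite subr_gt0.
apply: (mulIf epsk); rewrite divfK// mulrDl mulr_suml.
rewrite (_ : psum _ _ * _ * _ = \sum_i g i *
    \sum_(0 <= j < k.+1) psum (hasse c j) y * (eps * d i) ^+ j).
  rewrite -big_split/=; apply: eq_bigr => i _.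
  by rewrite -mulrA /rem divfK// -mulrDr subrK fE.
under [RHS]eq_bigr do rewrite mulr_sumr.
rewrite exchange_big/= big_nat_recr//= [X in _ = X + _]big_nat_cond
  [X in _ = X + _]big1 ?add0r.
  rewrite mulrAC mulr_sumr; apply: eq_bigr => i _.
  by rewrite exprMn; ring.
move=> s; rewrite andbT => /andP[_ sk].
rewrite (_ : \sum_i _ = eps ^+ s * (psum (hasse c s) y * \sum_i g i * d i ^+ s)).
  by rewrite van// mulr0.
rewrite !mulr_sumr; apply: eq_bigr => i _.
by rewrite exprMn; ring.
Unshelve. all: by end_near. Qed.

Lemma cvg_combination (I : finType) (g d : I -> R) (k : nat) :
  (forall s, (s < k)%N -> c s * \sum_i g i * d i ^+ s = 0) ->
  ((\sum_i g i * f (eps * d i)) / eps ^+ k) @[eps --> 0^'+] -->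
    c k * \sum_i g i * d i ^+ k.
Proof.
move=> van; have := @cvg_combination_at I g d 0 k.
rewrite normr0 psum_hasse0 => /(_ rho0) H.
rewrite (_ : (fun _ => _) = fun eps =>
    (\sum_i g i * f (0 + eps * d i)) / eps ^+ k).
  by apply: H => s sk; rewrite psum_hasse0 van.
by apply/funext => eps; under [in RHS]eq_bigr do rewrite add0r.
Qed.

End Limits.

(** * Moments and bordered determinants *)

Section Moments.
Context {R : realType}.

Definition moment (I : finType) (y a : I -> R) k : R := \sum_i a i * y i ^+ k.

Lemma difference_moment (I J : finType) (y a : I -> R) (z b : J -> R) s :
  \sum_i \sum_j a i * b j * (y i - z j) ^+ s =
  \sum_(k < s.+1) (-1) ^+ k * 'C(s, k)%:R * moment y a (s - k) * moment z b k.
Proof.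
have E i j : (y i - z j) ^+ s =
    \sum_(k < s.+1) (-1) ^+ k * 'C(s, k)%:R * y i ^+ (s - k) * z j ^+ k.
  by rewrite exprBn; apply: eq_bigr => k _; rewrite -mulr_natr; ring.
under eq_bigr do under eq_bigr do rewrite E mulr_sumr.
under eq_bigr do rewrite exchange_big/=.
rewrite exchange_big/=; apply: eq_bigr => k _.
rewrite /moment -[RHS]mulrA mulr_suml mulr_sumr; apply: eq_bigr => i _.
rewrite mulr_sumr mulr_sumr; apply: eq_bigr => j _.
by ring.
Qed.

Lemma even_moment (I : finType) (y a b : I -> R) s : ~~ odd s ->
  \sum_i \sum_j a i * b j * `|y i - y j| ^+ s =
  \sum_(k < s.+1) (-1) ^+ k * 'C(s, k)%:R * moment y a (s - k) * moment y b k.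
Proof.
move=> es; rewrite -difference_moment.
by under eq_bigr do under eq_bigr do rewrite -normrX ger0_norm ?exprn_even_ge0//.
Qed.

End Moments.

Section Saddle.
Context {R : realType}.

(** The signed bordered determinant that defines an extended L-ensemble. *)
Definition saddle m q (L : 'M[R]_m) (V : 'M[R]_(m, q)) : R :=
  (-1) ^+ q * \det (block_mx L V V^T 0).

(** Elementary block operations remove everything but the last diagonal block of N;
    the remaining block -1 of size q accounts for the sign. *)
Lemma saddle_canonical q d (N : 'M[R]_(q + d)) :
  saddle N (col_mx 1%:M 0 : 'M[R]_(q + d, q)) = \det (drsubmx N).
Proof.
rewrite /saddle -[N]submxK; set A := ulsubmx N; set B := ursubmx N.
set C := dlsubmx N; set D := drsubmx N.
rewrite block_mxKdr tr_col_mx trmx1 trmx0.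
set M := block_mx _ _ _ _.
pose R1 : 'M[R]_(q + d + q) := block_mx 1%:M 0 (row_mx (1%:M - A) (- B)) 1%:M.
pose R2 : 'M[R]_(q + d + q) := block_mx 1%:M (col_mx (- 1%:M) 0) 0 1%:M.
pose R3 : 'M[R]_(q + d + q) := block_mx 1%:M (col_mx 0 (- C)) 0 1%:M.
have H : R3 *m (M *m R1 *m R2) =
    block_mx (block_mx 1%:M 0 0 D) 0 (row_mx 1%:M 0) (- 1%:M).
  rewrite /M /R1 /R2 /R3 !mulmx_block.
  rewrite !(mulmx1, mul1mx, mulmx0, mul0mx, addr0, add0r).
  rewrite !mul_col_row !(mul_mx_row, mul_row_col, mul_col_mx, mulmx1, mul1mx, mulmx0, mul0mx, addr0, add0r).
  rewrite !add_block_mx mul_block_col !add_col_mx.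
  rewrite !(mulmxN, mulmx1, mulmx0, addr0, add0r, subrr, addrN, subrK, subrKC).
  rewrite ?(addrC A) ?subrK ?subrr ?opprK ?addNr ?col_mx0 //.
have := congr1 determinant H.
rewrite !det_mulmx.
rewrite /R1 /R2 /R3 det_lblock !det_ublock !det1 !mul1r !mulr1.
rewrite det_lblock det_ublock det1 mul1r => ->.
by rewrite -(scaleN1r (1%:M : 'M[R]_q)) detZ det1 mulr1 mulrCA -expr2 sqrr_sign mulr1.
Qed.
End Saddle.

Section Congruence.
Context {R : realType}.

Lemma congr_entry m p (A : 'M[R]_(p, m)) (M : 'M[R]_m) a b :
  (A *m M *m A^T) a b = \sum_(ij : 'I_m * 'I_m) A a ij.1 * A b ij.2 * M ij.1 ij.2.
Proof.
rewrite -(pair_bigA _ (fun i j => A a i * A b j * M i j)) exchange_big/= mxE.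
apply: eq_bigr => j _; rewrite mxE mulr_suml; apply: eq_bigr => i _.
by rewrite mxE mulrAC.
Qed.

Lemma saddle_congr m q (U N : 'M[R]_m) (E : 'M[R]_(m, q)) :
  saddle (U *m N *m U^T) (U *m E) = \det U ^+ 2 * saddle N E.
Proof.
have H : block_mx (U *m N *m U^T) (U *m E) (U *m E)^T 0 =
    block_mx U 0 0 1%:M *m block_mx N E E^T 0 *m block_mx U^T 0 0 1%:M.
  rewrite !mulmx_block trmx_mul.
  by rewrite !(mulmx1, mul1mx, mulmx0, mul0mx, addr0, add0r).
rewrite /saddle H !det_mulmx !det_lblock !det1 det_tr !mulr1; ring.
Qed.

Lemma vanderE n (x : 'I_n -> R) q i j : vander x q i j = x i ^+ j.
Proof. by rewrite !mxE. Qed.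

Lemma vander_unit m (y : 'I_m -> R) : injective y -> vander y m \in unitmx.
Proof.
move=> yinj; rewrite unitmxE unitfE /vander det_tr det_Vandermonde.
apply/prodf_neq0 => i _; apply/prodf_neq0 => j ij.
rewrite !mxE subr_eq0; apply/eqP => /yinj ji.
by rewrite ji ltnn in ij.
Qed.

(** The rows of the inverse Vandermonde matrix are the functionals dual to the
    monomials. *)
Lemma moment_dual m (y : 'I_m -> R) (a : 'I_m) (k : nat) : injective y ->
  (k < m)%N -> moment y (invmx (vander y m) a) k = (k == a)%:R.
Proof.
move=> yinj km; rewrite /moment.
have := congr1 (fun M : 'M[R]_m => M a (Ordinal km)) (mulVmx (vander_unit yinj)).
rewrite !mxE -val_eqE/= eq_sym => <-.
by apply: eq_bigr => i _; rewrite vanderE.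
Qed.

(** In the basis dual to the monomials the border becomes the first q basis
    vectors, which reduces the claim to [saddle_canonical]. *)
Lemma saddle_vander q d (y : 'I_(q + d) -> R) (L : 'M[R]_(q + d)) : injective y ->
  let U := vander y (q + d) in
  saddle L (vander y q) =
    \det U ^+ 2 * \det (drsubmx (invmx U *m L *m (invmx U)^T)).
Proof.
move=> yinj U; have Uu : U \in unitmx by exact: vander_unit.
rewrite -saddle_canonical -saddle_congr !mulmxA mulmxV// mul1mx.
rewrite -mulmxA -trmx_mul mulmxV// trmx1 mulmx1; congr saddle.
rewrite -[U]hsubmxK mul_row_col mulmx1 mulmx0 addr0.
by apply/matrixP => i j; rewrite !mxE.
Qed.

End Congruence.

(** * The order in eps of the kernel determinants *)

Section KernelDeterminant.
Context {R : realType}.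
Variable c : nat -> R.

(** The Wronskian at 0 of f|x - y|, in terms of the Taylor coefficients of f; it is
    meaningful when the odd coefficients below 2q - 1 vanish, see [wronskianE]. *)
Definition flat_wronskian q : 'M[R]_q := \matrix_(a, b) ((-1) ^+ b * hasse c b a).

Lemma flat_wronskian_sym q : (forall s, odd s -> (s < 2 * q - 1)%N -> c s = 0) ->
  (flat_wronskian q)^T = flat_wronskian q.
Proof.
move=> codd; apply/matrixP => a b; rewrite !mxE /hasse.
have [ab|ab] := boolP (odd (a + b)).
  by rewrite addnC codd ?mul0r ?mulr0//; have := ltn_ord a; have := ltn_ord b; lia.
by rewrite (sign_same_parity ab) (addnC b) -(bin_sub (leq_addl a b)) addnK.
Qed.

(** The row exponents are 0, ..., q - 1, q, q, ... and the column exponents are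
    0, ..., q - 1, q - 1, q - 1, ... This asymmetry replaces the half-integral
    exponents q - 1/2 of the symmetric scaling; its price is a limit that is only
    block triangular. *)
Definition flat_exponent q m := (\sum_(a < m) (minn a q + minn a q.-1))%N.

Section Fixed.
Variables (m q : nat) (y : 'I_m -> R).
Hypotheses (yinj : injective y) (qm : (q <= m)%N)
  (codd : forall s, odd s -> (s < 2 * q - 1)%N -> c s = 0).
Let Ui := invmx (vander y m).
Let e (a b : 'I_m) := (minn a q + minn b q.-1)%N.

Let mom0 (a : 'I_m) k : (k < minn a q)%N -> moment y (Ui a) k = 0.
Proof.
rewrite leq_min => /andP[ka kq]; rewrite moment_dual//; last exact: leq_trans qm.
by rewrite ltn_eqF.
Qed.

Let dist_sum (a b : 'I_m) s : ~~ odd s ->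
  \sum_(ij : 'I_m * 'I_m) Ui a ij.1 * Ui b ij.2 * `|y ij.1 - y ij.2| ^+ s =
  \sum_(k < s.+1) (-1) ^+ k * 'C(s, k)%:R * moment y (Ui a) (s - k) * moment y (Ui b) k.
Proof.
move=> es; rewrite -even_moment//.
by rewrite -(pair_bigA _ (fun i j => Ui a i * Ui b j * `|y i - y j| ^+ s)).
Qed.

(** A functional dual to the monomial of degree a kills all other monomials of
    degree less than q, so a product x^(s-k) y^k contributes to the entry (a, b)
    only when s - k and k reach the exponents of row a and column b. *)
Let low_vanish (a b : 'I_m) s : (s < e a b)%N ->
  c s * \sum_(ij : 'I_m * 'I_m) Ui a ij.1 * Ui b ij.2 * `|y ij.1 - y ij.2| ^+ s = 0.
Proof.
rewrite /e => se; have [os|es] := boolP (odd s).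
  by rewrite codd ?mul0r//; lia.
rewrite dist_sum// big1 ?mulr0// => k _.
have [ka|ka] := ltnP (s - k) (minn a q); first by rewrite (mom0 ka) mulr0 mul0r.
have kb : (k < minn b q)%N by have := ltn_ord k; lia.
by rewrite (mom0 kb) mulr0.
Qed.

Definition scaled_limit : 'M[R]_m :=
  \matrix_(a, b) (c (e a b) * (Ui *m dist_mx y (e a b) *m Ui^T) a b).

Lemma scaled_limit_ul (a b : 'I_m) : (a < q)%N -> (b < q)%N ->
  scaled_limit a b = (-1) ^+ b * hasse c b a.
Proof.
move=> aq bq; rewrite mxE congr_entry.
have -> : e a b = (a + b)%N by rewrite /e; lia.
under eq_bigr do rewrite mxE.
rewrite /hasse; have [os|es] := boolP (odd (a + b)).
  by rewrite codd ?mul0r ?mulr0//; lia.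
have bab : (b < (a + b).+1)%N by lia.
rewrite dist_sum// (bigD1 (Ordinal bab))//= big1 ?addr0; last first.
  move=> k; rewrite -val_eqE/= => kb.
  have [kb'|bk] := ltnP k b; first by rewrite (mom0 (k := k)) ?mulr0//; lia.
  have kab := ltn_ord k.
  by rewrite (mom0 (k := a + b - k)) ?mulr0 ?mul0r//; lia.
rewrite addnK !moment_dual ?eqxx//=; ring.
Qed.

(** Column exponents stop at q - 1: a column b >= q would need a monomial of degree
    at least q, which is one more than the available exponent. *)
Lemma scaled_limit_ur (a b : 'I_m) : (a < q)%N -> (q <= b)%N -> scaled_limit a b = 0.
Proof.
move=> aq bq; rewrite mxE congr_entry.
have -> : e a b = (a + q.-1)%N by rewrite /e; lia.
under eq_bigr do rewrite mxE.
have [os|es] := boolP (odd (a + q.-1)).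
  by rewrite codd ?mul0r ?mulr0//; lia.
rewrite dist_sum// big1 ?mulr0// => k _.
have [kb|kb] := ltnP k q; first by rewrite (mom0 (k := k)) ?mulr0//; lia.
have kaq := ltn_ord k.
by rewrite (mom0 (k := a + q.-1 - k)) ?mulr0 ?mul0r//; lia.
Qed.

Lemma scaled_limit_dr (a b : 'I_m) : (q <= a)%N -> (q <= b)%N ->
  scaled_limit a b =
    (Ui *m (c (2 * q - 1) *: dist_mx y (2 * q - 1)) *m Ui^T) a b.
Proof.
move=> aq bq; rewrite mxE.
have -> : e a b = (2 * q - 1)%N by rewrite /e; lia.
by rewrite -scalemxAr -scalemxAl [RHS]mxE.
Qed.

Variables (f : R -> R) (rho : R).
Hypotheses (rho0 : 0 < rho) (cvgc : converges_within c rho)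
  (fE : forall t, `|t| < rho -> f t = psum c t).

Lemma scaled_entry_cvg a b :
  ((Ui *m kernel_mx f y eps *m Ui^T) a b / eps ^+ e a b) @[eps --> 0^'+]
    --> scaled_limit a b.
Proof.
have -> : scaled_limit a b = c (e a b) * \sum_(ij : 'I_m * 'I_m)
    Ui a ij.1 * Ui b ij.2 * `|y ij.1 - y ij.2| ^+ e a b.
  by rewrite mxE congr_entry; congr (_ * _); apply: eq_bigr => ij _; rewrite mxE.
rewrite (_ : (fun _ => _) = fun eps => (\sum_(ij : 'I_m * 'I_m)
    Ui a ij.1 * Ui b ij.2 * f (eps * `|y ij.1 - y ij.2|)) / eps ^+ e a b).
  2: by apply/funext => eps; rewrite congr_entry; under eq_bigr do rewrite mxE.
apply: (cvg_combination rho0 cvgc fE (g := fun ij => Ui a ij.1 * Ui b ij.2)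
  (d := fun ij => `|y ij.1 - y ij.2|)) => s.
exact: low_vanish.
Qed.

Lemma det_kernel_cvg_scaled :
  (\det (kernel_mx f y eps) / eps ^+ flat_exponent q m) @[eps --> 0^'+] -->
    \det (vander y m) ^+ 2 * \det scaled_limit.
Proof.
pose Z eps : 'M[R]_m :=
  \matrix_(a, b) ((Ui *m kernel_mx f y eps *m Ui^T) a b / eps ^+ e a b).
have H : (\det (vander y m) ^+ 2 * \det (Z eps)) @[eps --> 0^'+] -->
    \det (vander y m) ^+ 2 * \det scaled_limit.
  apply: cvgM; first exact: cvg_cst.
  apply: cvg_det => a b.
  under eq_fun do rewrite mxE.
  exact: scaled_entry_cvg.
apply: cvg_trans H; apply: near_eq_cvg; near=> eps.
have eps0 : eps != 0 by near: eps; exact: nbhs_right_neq.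
have ZE : Z eps = diag_mx (\row_a eps ^- (minn a q)) *m
    (Ui *m kernel_mx f y eps *m Ui^T) *m diag_mx (\row_b eps ^- (minn b q.-1)).
  apply/matrixP => a b; rewrite [LHS]mxE mul_mx_diag mul_diag_mx.
  move: (Ui *m _ *m _) => N; rewrite !mxE /e exprD invfM.
  by rewrite mulrCA mulrA.
rewrite ZE !det_mulmx !det_diag.
have Uu : \det (vander y m) != 0 by rewrite -unitfE -unitmxE; exact: vander_unit.
have PE (g : 'I_m -> nat) :
    \prod_i (\row_a eps ^- g a) 0 i = (eps ^+ (\sum_i g i)%N)^-1.
  by under eq_bigr do rewrite mxE; rewrite prodfV prodrXr.
rewrite !PE (det_tr Ui) det_inv /flat_exponent big_split/= exprD.
by field; rewrite Uu !expf_neq0.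
Unshelve. all: by end_near. Qed.

End Fixed.

Variables (f : R -> R) (rho : R).
Hypotheses (rho0 : 0 < rho) (cvgc : converges_within c rho)
  (fE : forall t, `|t| < rho -> f t = psum c t).


Lemma det_kernel_cvg m q (y : 'I_m -> R) : injective y -> (q <= m)%N ->
  (forall s, odd s -> (s < 2 * q - 1)%N -> c s = 0) ->
  (\det (kernel_mx f y eps) / eps ^+ flat_exponent q m) @[eps --> 0^'+] -->
    \det (flat_wronskian q) *
      saddle (c (2 * q - 1) *: dist_mx y (2 * q - 1)) (vander y q).
Proof.
move=> yinj qm codd.
have [d dE] : exists d, m = (q + d)%N by exists (m - q)%N; rewrite subnKC.
subst m; have H := det_kernel_cvg_scaled yinj qm codd rho0 cvgc fE.
rewrite saddle_vander// mulrCA.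
set S := scaled_limit q y in H; set N := invmx _ *m _ *m _.
have SE : S = block_mx (flat_wronskian q) 0 (dlsubmx S) (drsubmx N).
  rewrite -[LHS]submxK; congr block_mx; apply/matrixP => a b.
  - transitivity (S (lshift d a) (lshift d b)); first by rewrite !mxE.
    by rewrite /S scaled_limit_ul//= [RHS]mxE.
  - transitivity (S (lshift d a) (rshift q b)); first by rewrite !mxE.
    by rewrite /S scaled_limit_ur//= ?leq_addr// [RHS]mxE.
  - transitivity (S (rshift q a) (rshift q b)); first by rewrite !mxE.
    rewrite /S scaled_limit_dr//= ?leq_addr//.
    by rewrite -/N; move: (N) => N'; rewrite !mxE.
by rewrite SE det_lblock in H.
Qed.
End KernelDeterminant.

(** * Strict definiteness of the distance matrices *)

Section FiniteForms.
Context {R : realType}.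

Lemma qformE m (A : 'M[R]_m) (u : 'cV[R]_m) :
  qform A u = \sum_i \sum_j u i 0 * u j 0 * A i j.
Proof.
rewrite /qform -[in X in _ *m X](trmxK u) congr_entry.
rewrite pair_bigA; apply: eq_bigr => ij _.
by rewrite !mxE.
Qed.

Lemma posdefmx_det_neq0 m (A : 'M[R]_m) : posdefmx A -> \det A != 0.
Proof.
move=> [_ Apos]; apply/det0P => -[v v0 vA].
have := Apos v^T; rewrite trmx_eq0 => /(_ v0).
by rewrite /qform trmxK vA mul0mx mxE ltxx.
Qed.

(** A null vector of a semidefinite form is orthogonal to everything. *)
Lemma quadratic_ge0_slope (B C : R) :
  (forall t, 0 <= 2 * t * B + t ^+ 2 * C) -> B = 0.
Proof.
move=> H; have C0 : 0 <= C by have := H 1; have := H (-1); lra.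
have := H (- B / (C + 1)).
rewrite (_ : _ + _ = - (B ^+ 2 * (C + 2)) / (C + 1) ^+ 2); last by field; lra.
rewrite mulNr oppr_ge0 pmulr_lle0 ?invr_gt0 ?exprn_gt0 ?ltr_wpDl//.
rewrite pmulr_lle0 ?ltr_wpDl// => B2.
by apply/eqP; rewrite -sqrf_eq0 eq_le B2 sqr_ge0.
Qed.

Lemma form_sumE (I J : finType) (z a : I -> R) (z' b : J -> R) (t : R) (h : R -> R) :
  let Z (k : I + J) := match k with inl i => z i | inr j => z' j end in
  let A (k : I + J) := match k with inl i => a i | inr j => t * b j end in
  \sum_k \sum_l A k * A l * h `|Z k - Z l| =
  \sum_i \sum_j a i * a j * h `|z i - z j| +
  2 * t * \sum_j \sum_i b j * a i * h `|z' j - z i| +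
  t ^+ 2 * \sum_i \sum_j b i * b j * h `|z' i - z' j|.
Proof.
rewrite /= big_sumType/=.
under eq_bigr do rewrite big_sumType/=.
under [X in _ + X]eq_bigr do rewrite big_sumType/=.
rewrite !big_split/= [X in _ + X + _]exchange_big/= -!addrA; congr (_ + _).
rewrite addrA; congr (_ + _).
  rewrite -big_split/= mulr_sumr; apply: eq_bigr => j _.
  rewrite -big_split/= mulr_sumr; apply: eq_bigr => i _.
  by rewrite distrC; ring.
rewrite mulr_sumr; apply: eq_bigr => i _; rewrite mulr_sumr; apply: eq_bigr => j _.
by ring.
Qed.

Section Kernel.
Variables (kappa : R -> R -> R) (f : R -> R).
Hypotheses (kappa_pd : posdef_kernel kappa) (kappa_stat : stationary kappa f).

Lemma kernel_form_ge0 (I : finType) (z a : I -> R) : injective z ->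
  0 <= \sum_i \sum_j a i * a j * f `|z i - z j|.
Proof.
move=> zinj; pose y := z \o (@enum_val I xpredT).
have yinj : injective y by move=> i j /zinj /enum_val_inj.
pose u : 'cV[R]_#|I| := \col_i a (enum_val i).
suff -> : \sum_i \sum_j a i * a j * f `|z i - z j| =
    qform (\matrix_(i, j) kappa (y i) (y j)) u.
  have [->|u0] := eqVneq u 0; last by apply: ltW; case: (kappa_pd yinj) => _; apply.
  by rewrite /qform mulmx0 mxE.
rewrite qformE (reindex _ (onW_bij _ (enum_val_bij I))).
apply: eq_bigr => i _; rewrite (reindex _ (onW_bij _ (enum_val_bij I))).
by apply: eq_bigr => j _; rewrite !mxE kappa_stat.
Qed.

Lemma kernel_matrix_posdef n (x : 'I_n -> R) eps : 0 < eps -> injective x ->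
  posdefmx (kernel_mx f x eps).
Proof.
move=> eps0 xinj.
have -> : kernel_mx f x eps = \matrix_(i, j) kappa (eps * x i) (eps * x j).
  apply/matrixP => i j; rewrite !mxE kappa_stat -mulrBr normrM.
  by rewrite (gtr0_norm eps0).
apply: kappa_pd => i j /mulfI; rewrite (gt_eqF eps0) => /(_ isT) /xinj; exact.
Qed.

Variables (c : nat -> R) (rho : R).
Hypotheses (rho0 : 0 < rho) (cvgc : converges_within c rho)
  (fE : forall t, `|t| < rho -> f t = psum c t).

Section Distance.
Variable (q : nat).
Hypothesis (q0 : (0 < q)%N)
  (codd : forall s, odd s -> (s < 2 * q - 1)%N -> c s = 0).

(** The form is the limit of the nonnegative kernel forms of the points eps z_i,
    divided by eps^(2q-1): the moment conditions cancel the even powers below. *)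
Lemma distance_form_ge0 (I : finType) (z a : I -> R) : injective z ->
  (forall k, (k < q)%N -> moment z a k = 0) ->
  0 <= c (2 * q - 1) * \sum_i \sum_j a i * a j * `|z i - z j| ^+ (2 * q - 1).
Proof.
move=> zinj az.
pose g (ij : I * I) := a ij.1 * a ij.2.
pose d (ij : I * I) := `|z ij.1 - z ij.2|.
have := @cvg_combination _ f c rho rho0 cvgc fE _ g d (2 * q - 1).
have sumE s : \sum_ij g ij * d ij ^+ s = \sum_i \sum_j a i * a j * `|z i - z j| ^+ s.
  by rewrite (pair_bigA _ (fun i j => a i * a j * `|z i - z j| ^+ s)).
rewrite sumE => H.
apply: (cvgr_to_ge (H _)) => [s sq|].
  have [os|es] := boolP (odd s); first by rewrite codd ?mul0r//; lia.
  rewrite sumE even_moment// big1 ?mulr0// => k _.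
  have [kq|kq] := ltnP k q; first by rewrite (az k)// mulr0.
  by rewrite (az (s - k)%N) ?mulr0 ?mul0r//; have := ltn_ord k; lia.
near=> eps; have eps0 : 0 < eps by near: eps; exact: nbhs_right_gt.
rewrite divr_ge0 ?exprn_ge0 ?(ltW eps0)//.
rewrite -(pair_bigA _ (fun i j => a i * a j * f (eps * `|z i - z j|)))/=.
rewrite [leRHS](_ : _ = \sum_i \sum_j a i * a j * f `|eps * z i - eps * z j|).
  by apply: kernel_form_ge0 => i j /mulfI; rewrite (gt_eqF eps0) => /(_ isT) /zinj.
apply: eq_bigr => i _; apply: eq_bigr => j _.
by rewrite -mulrBr normrM (gtr0_norm eps0).
Unshelve. all: by end_near. Qed.

(** A null vector u interacts with no combination of further points that kills the
    polynomials of degree less than q. Take as further points one point z0 just to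
    the left of the rightmost active node and q points to the right of all nodes.
    To the right of the active nodes the potential of u is a polynomial of degree
    less than q, which the combination kills, while at z0 it differs from this
    polynomial by a multiple of (z0 - y)^(2q-1). *)
Lemma distance_form_definite m (y u : 'I_m -> R) : injective y ->
  c (2 * q - 1) != 0 ->
  (forall k, (k < q)%N -> moment y u k = 0) ->
  \sum_i \sum_j u i * u j * `|y i - y j| ^+ (2 * q - 1) = 0 ->
  forall i, u i = 0.
Proof.
move=> yinj cq um unull; apply: contrapT => /existsNP[i /eqP ui].
pose i0 := [arg max_(j > i | u j != 0) y j]%O.
have [ui0 i0max] : u i0 != 0 /\ forall j, u j != 0 -> y j <= y i0.
  by rewrite /i0; case: arg_maxP => // j uj jmax; split.
set s := (2 * q - 1)%N in cq unull *.
have os : odd s by rewrite /s; lia.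
(* z0 lies strictly between the rightmost active node and the nodes before it *)
have [z0 z0Y z0y] : exists2 z0, z0 < y i0 & forall j, y j < y i0 -> y j < z0.
  have : \forall e \near (0 : R)^'+, forall j, y j < y i0 -> y j < y i0 - e.
    apply: filter_forall => j; have [yj|yj] := ltP (y j) (y i0); last by near=> e.
    near=> e => _; have : e < y i0 - y j.
      by near: e; apply: nbhs_right_lt; rewrite subr_gt0.
    by lra.
  move=> H; have : \forall e \near (0 : R)^'+, exists2 z0, z0 < y i0 &
      forall j, y j < y i0 -> y j < z0.
    near=> e; exists (y i0 - e); last by near: e.
    by rewrite gtrBl; near: e; exact: nbhs_right_gt.
  by move/filter_ex => [e].
(* w and the weight 1 at z0 form a divided difference of order q *)
pose T := 1 + \sum_j `|y j|.
have yT j : y j < T.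
  apply: (le_lt_trans (ler_norm _)); rewrite /T (bigD1 j)//=.
  by rewrite addrCA ltrDl ltr_pwDl// sumr_ge0.
pose zz (k : 'I_q) := T + k%:R.
have zzinj : injective zz.
  by move=> k l /addrI/eqP; rewrite eqr_nat => /eqP/val_inj.
have yzz j k : y j < zz k by rewrite (lt_le_trans (yT j))// lerDl.
pose w (k : 'I_q) := - \sum_(l < q) z0 ^+ l * invmx (vander zz q) l k.
have wm l : (l < q)%N -> moment zz w l = - z0 ^+ l.
  move=> lq; rewrite /moment.
  under eq_bigr do rewrite mulNr mulr_suml.
  rewrite sumrN exchange_big/= (bigD1 (Ordinal lq))//= [X in _ + X]big1 ?addr0.
    under eq_bigr do rewrite -mulrA.
    rewrite -mulr_sumr; have := moment_dual (Ordinal lq) zzinj lq.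
    by rewrite /moment eqxx => ->; rewrite mulr1.
  move=> k; rewrite -val_eqE/= => kl.
  under eq_bigr do rewrite -mulrA.
  rewrite -mulr_sumr; have := moment_dual k zzinj lq.
  by rewrite /moment eq_sym (negbTE kl) => ->; rewrite mulr0.
pose Z (k : 'I_q + 'I_1) := if k is inl k then zz k else z0.
pose W (k : 'I_q + 'I_1) := if k is inl k then w k else 1.
have Wm l : (l < q)%N -> moment Z W l = 0.
  by move=> lq; rewrite /moment big_sumType/= big_ord1 mul1r [X in X + _]wm// addNr.
have cross : \sum_k \sum_j W k * u j * `|Z k - y j| ^+ s =
    - 2 * u i0 * (z0 - y i0) ^+ s.
  have zero : \sum_k \sum_j W k * u j * (Z k - y j) ^+ s = 0.
    rewrite difference_moment big1// => k _.
    have [kq|kq] := ltnP k q; first by rewrite um// mulr0.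
    by rewrite Wm ?mulr0 ?mul0r//; have := ltn_ord k; lia.
  apply/eqP; rewrite -subr_eq0 -[X in X - _]subr0 -[X in _ - X - _]zero; apply/eqP.
  rewrite !big_sumType/= !big_ord1.
  rewrite (_ : \sum_(k < q) _ = \sum_(k < q) \sum_j w k * u j * (zz k - y j) ^+ s).
    rewrite opprD addrACA subrr add0r -sumrB (bigD1 i0)//= big1 ?addr0.
      have -> : `|z0 - y i0| ^+ s = - (z0 - y i0) ^+ s.
        by rewrite ltr0_norm ?subr_lt0// exprNn -signr_odd os expr1 mulN1r.
      by ring.
    move=> j ji0; have [uj|uj] := eqVneq (u j) 0.
      by rewrite uj !(mulr0, mul0r) subr0.
    have : y j < z0.
      by apply: z0y; rewrite lt_neqAle i0max// andbT; apply: contra ji0 => /eqP/yinj->.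
    by move=> yz; rewrite ger0_norm ?subrr// subr_ge0 ltW.
  apply: eq_bigr => k _; apply: eq_bigr => j _.
  by rewrite ger0_norm// subr_ge0 ltW.
pose ZZ (a : 'I_m + ('I_q + 'I_1)) := match a with inl j => y j | inr k => Z k end.
have ZZinj : injective ZZ.
  have y0 j : y j != z0.
    have [/z0y yz|yY] := ltP (y j) (y i0); first by rewrite lt_eqF.
    by rewrite gt_eqF// (lt_le_trans z0Y).
  have z0z k : z0 != zz k by rewrite lt_eqF// (lt_trans z0Y).
  move=> [j|[k|k]] [j'|[k'|k']] //=.
  - by move/yinj ->.
  - by move=> E; have := yzz j k'; rewrite E ltxx.
  - by move=> E; have := y0 j; rewrite E eqxx.
  - by move=> E; have := yzz j' k; rewrite E ltxx.
  - by move/zzinj ->.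
  - by move=> E; have := z0z k; rewrite E eqxx.
  - by move=> E; have := y0 j'; rewrite E eqxx.
  - by move=> E; have := z0z k'; rewrite E eqxx.
  - by rewrite (ord1 k) (ord1 k').
have H t : 0 <= 2 * t * (c s * (- 2 * u i0 * (z0 - y i0) ^+ s)) +
    t ^+ 2 * (c s * \sum_k \sum_l W k * W l * `|Z k - Z l| ^+ s).
  pose UW (a : 'I_m + ('I_q + 'I_1)) := match a with inl j => u j | inr k => t * W k end.
  have := @distance_form_ge0 _ ZZ UW ZZinj.
  have UWm k : (k < q)%N -> moment ZZ UW k = 0.
    move=> kq; rewrite /moment big_sumType/= [X in X + _]um// add0r.
    under eq_bigr do rewrite -mulrA.
    by rewrite -mulr_sumr [X in _ * X]Wm// mulr0.
  move=> /(_ UWm); rewrite (form_sumE y u Z W t (fun v => v ^+ s)) unull add0r cross.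
  by rewrite mulrDr; congr (_ <= _ + _); rewrite !mulrA; congr (_ * _); ring.
have /eqP := quadratic_ge0_slope H.
by rewrite !mulf_eq0 (negbTE cq) (negbTE ui0) oppr_eq0 pnatr_eq0 expf_eq0 subr_eq0
  (lt_eqF z0Y) andbF.
Unshelve. all: by end_near. Qed.

End Distance.
End Kernel.
End FiniteForms.

(** * Positive definiteness of the Wronskian *)

Section WronskianPositivity.
Context {R : realType}.
Variables (kappa : R -> R -> R) (f : R -> R).
Hypotheses (kappa_pd : posdef_kernel kappa) (kappa_stat : stationary kappa f).
Variables (c : nat -> R) (rho : R).
Hypotheses (rho0 : 0 < rho) (cvgc : converges_within c rho)
  (fE : forall t, `|t| < rho -> f t = psum c t).

Section Size.
Variable (q : nat).
Hypothesis (codd : forall s, odd s -> (s < 2 * q - 1)%N -> c s = 0).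

(** The kernel form on the points - eps i with coefficients approximating the
    differential operator u, together with the point y with coefficient t. The
    cluster sits on the left of 0 so that it never meets y. *)
Lemma wronskian_probe (u : 'cV[R]_q) (y t : R) : 0 < y < rho ->
  0 <= qform (flat_wronskian c q) u +
    2 * t * \sum_b u b 0 * ((-1) ^+ b * psum (hasse c b) y) + t ^+ 2 * f 0.
Proof.
move=> /andP[y0 yrho].
pose node (i : 'I_q) : R := - i%:R.
have nodeinj : injective node.
  by move=> i j /oppr_inj/eqP; rewrite eqr_nat => /eqP/val_inj.
pose Ui := invmx (vander node q).
pose alpha eps i := \sum_a u a 0 * eps ^- a * Ui a i.
pose G eps := \sum_a \sum_b u a 0 * u b 0 *
    ((Ui *m kernel_mx f node eps *m Ui^T) a b / eps ^+ (minn a q + minn b q.-1)) +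
  2 * t * \sum_a u a 0 * ((\sum_i Ui a i * f (y + eps * - node i)) / eps ^+ a) +
  t ^+ 2 * f 0.
have GE eps : 0 < eps -> G eps = \sum_i \sum_j alpha eps i * alpha eps j *
     f `|eps * node i - eps * node j| +
   2 * t * \sum_(k < 1) \sum_i 1 * alpha eps i * f `|y - eps * node i| +
   t ^+ 2 * \sum_(k < 1) \sum_(l < 1) 1 * 1 * f `|y - y|.
  move=> eps0; rewrite /G; congr (_ + _ * _ + _ * _).
  - under [RHS]eq_bigr do under eq_bigr do rewrite -mulrBr normrM (gtr0_norm eps0).
    have Gab a b : (Ui *m kernel_mx f node eps *m Ui^T) a b /
        eps ^+ (minn a q + minn b q.-1) =
      \sum_i \sum_j (eps ^- a * Ui a i) * (eps ^- b * Ui b j) *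
        f (eps * `|node i - node j|).
      rewrite congr_entry -(pair_bigA _ (fun i j => Ui a i * Ui b j *
        kernel_mx f node eps i j))/= mulr_suml; apply: eq_bigr => i _.
      rewrite mulr_suml; apply: eq_bigr => j _; rewrite mxE.
      have -> : minn a q = a by have := ltn_ord a; lia.
      have -> : minn b q.-1 = b by have := ltn_ord b; lia.
      by rewrite exprD invfM; ring.
    under [LHS]eq_bigr do under eq_bigr do rewrite Gab mulr_sumr.
    under [LHS]eq_bigr do rewrite exchange_big/=.
    rewrite [LHS]exchange_big/=; apply: eq_bigr => i _.
    under [LHS]eq_bigr do under eq_bigr do rewrite mulr_sumr.
    under [LHS]eq_bigr do rewrite exchange_big/=.
    rewrite [LHS]exchange_big/=; apply: eq_bigr => j _.
    rewrite /alpha -mulrA mulr_suml; apply: eq_bigr => a _.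
    rewrite mulr_suml mulr_sumr; apply: eq_bigr => b _.
    by ring.
  - rewrite big_ord1; under [RHS]eq_bigr do rewrite mul1r mulr_suml.
    rewrite exchange_big/=; apply: eq_bigr => a _.
    rewrite mulr_suml mulr_sumr; apply: eq_bigr => i _.
    rewrite mulrN ger0_norm; first by ring.
    by rewrite /node mulrN opprK addr_ge0 ?(ltW y0)// mulr_ge0 ?(ltW eps0).
  - by rewrite !big_ord1 !mul1r subrr normr0.
have Gcvg : G eps @[eps --> 0^'+] --> qform (flat_wronskian c q) u +
    2 * t * \sum_b u b 0 * ((-1) ^+ b * psum (hasse c b) y) + t ^+ 2 * f 0.
  rewrite qformE; apply: cvgD; last exact: cvg_cst.
  apply: cvgD; last (apply: cvgM; first exact: cvg_cst).
  - apply: cvg_big; first exact: add_continuous.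
    move=> a _; apply: cvg_big; first exact: add_continuous.
    move=> b _; apply: cvgM; first exact: cvg_cst.
    rewrite mxE -(scaled_limit_ul nodeinj (leqnn q) codd (ltn_ord a) (ltn_ord b)).
    exact: (scaled_entry_cvg nodeinj (leqnn q) codd rho0 cvgc fE).
  - apply: cvg_big; first exact: add_continuous.
    move=> a _; apply: cvgM; first exact: cvg_cst.
    have mom k : (k < q)%N -> \sum_i Ui a i * (- node i) ^+ k = (-1) ^+ k * (k == a)%:R.
      move=> kq; rewrite -(moment_dual a nodeinj kq) /moment mulr_sumr.
      by apply: eq_bigr => i _; rewrite [in LHS]exprNn; ring.
    have := @cvg_combination_at _ f c rho cvgc fE _ (Ui a) (fun i => - node i) y a.
    rewrite mom// eqxx mulr1 [_ * (-1) ^+ _]mulrC; apply; first by rewrite gtr0_norm.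
    move=> s sa; rewrite mom; last exact: ltn_trans (ltn_ord a).
    by rewrite (ltn_eqF sa) !mulr0.
apply: (cvgr_to_ge Gcvg); near=> eps.
have eps0 : 0 < eps by near: eps; exact: nbhs_right_gt.
rewrite GE// -(form_sumE (fun i => eps * node i) (alpha eps) (fun=> y) (fun=> 1) t f).
apply: (kernel_form_ge0 kappa_pd kappa_stat).
move=> [i|i] [j|j] /=.
- by move/mulfI; rewrite (gt_eqF eps0) => /(_ isT)/nodeinj ->.
- move=> E; exfalso; move: y0; rewrite -E ltNge.
  by rewrite /node mulrN oppr_le0 mulr_ge0 ?(ltW eps0).
- move=> E; exfalso; move: y0; rewrite E ltNge.
  by rewrite /node mulrN oppr_le0 mulr_ge0 ?(ltW eps0).
- by rewrite (ord1 i) (ord1 j).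
Unshelve. all: by end_near. Qed.

Lemma flat_wronskian_ge0 (u : 'cV[R]_q) : 0 <= qform (flat_wronskian c q) u.
Proof.
have := @wronskian_probe u (rho / 2) 0.
by rewrite mulr0 mul0r expr0n mul0r !addr0; apply; rewrite divr_gt0//= ltr_pdivrMr// ltr_pMr// ltr1n.
Qed.

(** By [wronskian_probe] the differential operator u annihilates f on the interval
    from 0 to rho; these are the Taylor coefficients at 0 of the equation. *)
Lemma wronskian_null_recurrence (u : 'cV[R]_q) : qform (flat_wronskian c q) u = 0 ->
  forall i, \sum_b u b 0 * ((-1) ^+ b * hasse c b i) = 0.
Proof.
move=> unull.
have cvgh (b : 'I_q) := hasse_within (j := b) cvgc.
suff H i : \sum_b (u b 0 * (-1) ^+ b) * hasse c b i = 0.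
  by move=> i; rewrite -[RHS](H i); apply: eq_bigr => b _; rewrite mulrA.
move: i; pose cs i := \sum_b (u b 0 * (-1) ^+ b) * hasse c b i.
have cscv : converges_within cs rho.
  exact: (@converges_within_sum _ _ (fun b : 'I_q => u b 0 * (-1) ^+ b) _ _ cvgh).
refine (psum_identity cscv rho0 (lexx _) _) => y y0rho.
have /andP[y0 yrho] := y0rho.
rewrite (psum_sum _ cvgh) ?gtr0_norm//; apply: (@quadratic_ge0_slope _ _ (f 0)) => t.
have := wronskian_probe u t y0rho; rewrite unull add0r.
by under eq_bigr do rewrite mulrA.
Qed.

(** The Wronskian couples only indices of the same parity, so the reflection of a
    null vector is again a null vector. *)
Lemma wronskian_null_parity (u : 'cV[R]_q) (pi : bool) :
  qform (flat_wronskian c q) u = 0 ->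
  forall i, \sum_(b < q | odd b == pi) u b 0 * hasse c b i = 0.
Proof.
move=> unull i; have R1 := wronskian_null_recurrence unull i.
pose u' : 'cV[R]_q := \col_b ((-1) ^+ b * u b 0).
have u'null : qform (flat_wronskian c q) u' = 0.
  rewrite -unull !qformE; apply: eq_bigr => a _; apply: eq_bigr => b _.
  rewrite !mxE /hasse; have [ab|ab] := boolP (odd (a + b)).
    by rewrite codd ?(mul0r, mulr0)//; have := ltn_ord a; have := ltn_ord b; lia.
  rewrite (sign_same_parity ab) (_ : _ * _ * (_ * u b 0) = ((-1) ^+ b * (-1) ^+ b) * (u a 0 * u b 0)); last by ring.
  by rewrite -expr2 sqrr_sign mul1r.
have R2 := wronskian_null_recurrence u'null i.
rewrite big_mkcond/= (_ : \sum_b _ =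
  (\sum_b u' b 0 * ((-1) ^+ b * hasse c b i) +
   (-1) ^+ pi * \sum_b u b 0 * ((-1) ^+ b * hasse c b i)) / 2).
  by rewrite R1 R2 mulr0 addr0 mul0r.
rewrite mulr_sumr -big_split/= mulr_suml; apply: eq_bigr => b _.
rewrite mxE -[(-1) ^+ b]signr_odd.
by case: pi; case: (odd b) => /=; rewrite ?expr1 ?expr0; field.
Qed.

End Size.

Lemma top_entry q (u : 'cV[R]_q) : u != 0 ->
  exists2 b0 : 'I_q, u b0 0 != 0 & forall b : 'I_q, (b0 < b)%N -> u b 0 = 0.
Proof.
move=> u0; have [i ui] : exists i, u i 0 != 0.
  apply: contrapT => /forallNP H; move/eqP: u0; apply; apply/colP => i.
  by rewrite mxE; apply/eqP/negPn/negP/H.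
case: (@arg_maxnP _ i (fun b => u b 0 != 0) (fun b => b : nat)) => // b0 ub0 bmax.
exists b0 => // b bb; apply/eqP/negPn/negP => /bmax /= h.
by move: bb; rewrite ltnNge h.
Qed.

(** The recurrence restricted to the parity of the top entry b0 of a null vector,
    taken at the index 2k - 1 - b0, involves only odd coefficients and expresses
    c_{2k-1} through lower ones, which vanish. *)
Lemma flat_wronskian_posdef_finite q k : (q <= k)%N ->
  (forall s, odd s -> (s < 2 * k - 1)%N -> c s = 0) -> c (2 * k - 1) != 0 ->
  posdefmx (flat_wronskian c q).
Proof.
move=> qk codd ck.
have coddq s : odd s -> (s < 2 * q - 1)%N -> c s = 0.
  by move=> os sq; apply: codd => //; lia.
split=> [|u u0]; first exact: flat_wronskian_sym.
rewrite lt_neqAle flat_wronskian_ge0// andbT; apply/negP => /eqP/esym unull.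
have [b0 ub0 bmax] := top_entry u0.
have b0q := ltn_ord b0.
have := wronskian_null_parity coddq (odd b0) unull (2 * k - 1 - b0)%N.
rewrite (bigD1 b0)//= big1 ?addr0; last first.
  move=> b /andP[/eqP bb bb0]; have [b0b|bb0'] := ltnP b0 b; first by rewrite bmax ?mul0r.
  have ltb : (b < b0)%N by rewrite ltn_neqAle bb0.
  rewrite /hasse codd ?mul0r ?mulr0//; last by lia.
  have : odd (2 * k - 1 - b0 + b0) by rewrite subnK; lia.
  by rewrite !oddD bb.
rewrite /hasse subnK; last by lia.
move/eqP; rewrite !mulf_eq0 (negbTE ub0) (negbTE ck)/= pnatr_eq0.
by apply/negP; rewrite -lt0n bin_gt0; lia.
Qed.

(** The recurrence makes every Taylor coefficient of f at y a fixed linear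
    combination of those of index less than b0, uniformly in y. Expanding
    f(y - y') in powers of y' then exhibits kernel matrices on b0 + 1 points near 0
    as limits of matrices of rank at most b0, hence as singular matrices. *)
Lemma flat_wronskian_posdef_infinite q : (forall s, odd s -> c s = 0) ->
  posdefmx (flat_wronskian c q).
Proof.
move=> codd.
have coddq s : odd s -> (s < 2 * q - 1)%N -> c s = 0 by move=> os _; exact: codd.
split=> [|u u0]; first exact: flat_wronskian_sym.
rewrite lt_neqAle flat_wronskian_ge0// andbT; apply/negP => /eqP/esym unull.
have [b0 ub0 bmax] := top_entry u0.
have rec := wronskian_null_recurrence coddq unull.
pose y (p : 'I_b0.+1) : R := rho / 3 / p.+1%:R.
have y_lt p : `|y p| <= rho / 3.
  rewrite ger0_norm ?divr_ge0 ?(ltW rho0)// ler_pdivrMr// ler_peMr ?ler1n//.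
  by rewrite divr_ge0 ?(ltW rho0).
have yinj : injective y.
  move=> i j /(mulfI _) H; have : rho / 3 != 0 by rewrite mulf_neq0 ?gt_eqF ?invr_gt0.
  by move/H/invr_inj/eqP; rewrite eqr_nat eqSS => /eqP/val_inj.
pose eta j : 'rV[R]_b0.+1 := \row_p psum (hasse c j) (y p).
pose v (b : 'I_q) : R := u b 0 * (-1) ^+ b / b`!%:R.
have eta_rec j : \sum_b v b * (j + b)`!%:R *: eta (j + b)%N = 0.
  apply/rowP => p; rewrite summxE mxE.
  under eq_bigr do rewrite !mxE.
  rewrite -(psum_sum _ (fun b : 'I_q => hasse_within (j := (j + b)%N) cvgc)); last first.
    by apply: (le_lt_trans (y_lt p)); rewrite ltr_pdivrMr// ltr_pMr// ltr1n.
  rewrite -[RHS](psum_zero (y p)); congr psum.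
  apply/funext => i; have Rij := rec (i + j)%N.
  rewrite (_ : \sum_b _ = ((i + j)`!%:R / i`!%:R) *
    \sum_b u b 0 * ((-1) ^+ b * hasse c b (i + j))); first by rewrite Rij mulr0.
  rewrite mulr_sumr; apply: eq_bigr => b _; rewrite /v /hasse.
  have F n : (n`!%:R : R) != 0 by rewrite pnatr_eq0 -lt0n fact_gt0.
  rewrite !bin_ratio addnA.
  by field; rewrite !F.
pose H : 'M[R]_(b0, b0.+1) := \matrix_(a, p) eta a 0 p.
have eta_sub j : (eta j <= H)%MS.
  elim/ltn_ind: j => j IH; have [jb|bj] := ltnP j b0.
    rewrite (_ : eta j = row (Ordinal jb) H) ?row_sub//.
    by apply/rowP => p; rewrite [RHS]mxE [RHS]mxE.
  have := eta_rec (j - b0)%N; rewrite (bigD1 b0)//= subnK// => /eqP.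
  rewrite addr_eq0 => /eqP E.
  have vb0 : v b0 * j`!%:R != 0.
    have F n : (n`!%:R : R) != 0 by rewrite pnatr_eq0 -lt0n fact_gt0.
    by rewrite /v !mulf_neq0 ?signr_eq0 ?invr_neq0.
  rewrite -(scalerK vb0 (eta j)) E scalemx_sub// -scaleN1r scalemx_sub//.
  apply: summx_sub => b bb0; have [bb|bb] := ltnP b0 b.
    by rewrite /v bmax// !mul0r scale0r sub0mx.
  apply: scalemx_sub; apply: IH; have : (b < b0)%N by rewrite ltn_neqAle bb0.
  lia.
pose K N : 'M[R]_b0.+1 :=
  \matrix_(p, p') \sum_(0 <= j < N) psum (hasse c j) (y p) * (- y p') ^+ j.
have K0 N : \det (K N) = 0.
  have KH : ((K N)^T <= H)%MS.
    apply/row_subP => p'.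
    rewrite (_ : row p' _ = \sum_(0 <= j < N) (- y p') ^+ j *: eta j).
      by apply: summx_sub => j _; exact: scalemx_sub.
    apply/rowP => p; rewrite !mxE summxE; apply: eq_bigr => j _.
    by rewrite !mxE mulrC.
  apply/eqP/negPn/negP; rewrite -unitfE -unitmxE -unitmx_tr -row_free_unit.
  rewrite /row_free => /eqP rk; have := leq_trans (mxrankS KH) (rank_leq_row H).
  by rewrite rk ltnn.
have Kcvg : \det (K N) @[N --> \oo] --> \det (kernel_mx f y 1).
  apply: cvg_det => p p'; rewrite mxE mul1r.
  have -> : f `|y p - y p'| = psum c (y p + - y p').
    rewrite fE ?psum_even// normr_id (le_lt_trans (ler_normB _ _))//.
    by have := y_lt p; have := y_lt p'; have := rho0; lra.
  rewrite (_ : (fun _ => _) = fun N =>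
      \sum_(0 <= j < N) psum (hasse c j) (y p) * (- y p') ^+ j).
    apply: (taylor_series cvgc); rewrite normrN.
    by have := y_lt p; have := y_lt p'; have := rho0; lra.
  by apply/funext => N; rewrite mxE.
have := posdefmx_det_neq0 (kernel_matrix_posdef kappa_pd kappa_stat ltr01 yinj).
move/eqP; apply.
rewrite (_ : (fun N => \det (K N)) = fun=> 0) in Kcvg; last exact/funext.
by rewrite -(cvg_lim _ Kcvg)//; apply: cvg_lim => //; exact: cvg_cst.
Qed.

End WronskianPositivity.

(** * Identification of the Wronskian *)

Section WronskianDerivatives.
Context {R : realType}.

(** Iterated derivatives are total functions; a family that is differentiable on a
    whole neighbourhood identifies them step by step. *)
Lemma derive1n_family (g : R -> R) (G : nat -> R -> R) (rho : R) (M : nat) :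
  (forall t, `|t| < rho -> g t = G 0 t) ->
  (forall j t, (j < M)%N -> `|t| < rho -> is_derive t (1 : R) (G j) (G j.+1 t)) ->
  forall j t, (j <= M)%N -> `|t| < rho -> derive1n j g t = G j t.
Proof.
move=> g0 GD; elim=> [|j IH] t jM trho; first by rewrite derive1n0 g0.
rewrite derive1nS derive1E (@near_eq_derive _ _ _ _ (G j)).
  by have [_ ->] := GD j t jM trho.
have : \forall s \near t, `|s| < rho.
  near=> s; rewrite -(subrK t s) (le_lt_trans (ler_normD _ _))// -ltrBrDr.
  near: s; have : 0 < rho - `|t| by rewrite subr_gt0.
  move=> r0; near=> s; rewrite distrC; near: s.
  exact: (@cvgr_dist_lt _ _ _ _ _ id t).
by apply: filterS => s srho; rewrite IH// ltnW.
Unshelve. all: by end_near. Qed.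

Lemma is_derive_glue (F P Q : R -> R) (d : R) :
  (forall t, 0 <= t -> F t = P t) -> (forall t, t <= 0 -> F t = Q t) ->
  is_derive (0 : R) (1 : R) P d -> is_derive (0 : R) (1 : R) Q d ->
  is_derive (0 : R) (1 : R) F d.
Proof.
move=> FP FQ [Pder Pd] [Qder Qd].
have cP : (h^-1 *: (P (h *: 1 + 0) - P 0)) @[h --> 0^'] --> d by rewrite -Pd; exact: Pder.
have cQ : (h^-1 *: (Q (h *: 1 + 0) - Q 0)) @[h --> 0^'] --> d by rewrite -Qd; exact: Qder.
have cF : (h^-1 *: (F (h *: 1 + 0) - F 0)) @[h --> 0^'] --> d.
  apply/cvgrPdist_lt => e e0.
  have nP : \forall h \near 0^', `|d - h^-1 *: (P (h *: 1 + 0) - P 0)| < e.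
    by move/cvgrPdist_lt : cP; apply.
  have nQ : \forall h \near 0^', `|d - h^-1 *: (Q (h *: 1 + 0) - Q 0)| < e.
    by move/cvgrPdist_lt : cQ; apply.
  near=> h; have [h0|h0] := leP 0 h.
    rewrite !FP ?addr0 //; last by rewrite /GRing.scale/= mulr1.
    by have := near nP h; rewrite addr0; apply.
  rewrite !FQ ?addr0 //; last by rewrite /GRing.scale/= mulr1 ltW.
  by have := near nQ h; rewrite addr0; apply.
by apply: DeriveDef; [apply/cvg_ex; exists d|exact: cvg_lim].
Unshelve. all: by end_near. Qed.

Lemma is_derive_reflect (F : R -> R) (a t d : R) :
  is_derive (a - t) (1 : R) F d -> is_derive t (1 : R) (fun s => F (a - s)) (- d).
Proof.
move=> H; rewrite -mulrN1; apply: (@is_derive1_comp _ F (fun s => a - s)).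
by rewrite -[X in is_derive _ _ _ X]add0r; apply: is_deriveB.
Qed.

Variables (c : nat -> R) (rho : R).
Hypotheses (cvgc : converges_within c rho).

Lemma pseries_diffs_hasse j :
  pseries_diffs (hasse c j) = fun i => j.+1%:R * hasse c j.+1 i.
Proof.
apply/funext => i; rewrite /pseries_diffs /hasse addSnnS.
rewrite mulrCA [RHS]mulrCA -!natrM; congr (_ * _%:R).
by rewrite mul_bin_left addnS subSn ?leq_addl// addnK.
Qed.

Let pseries_scale (a : R) (b : nat -> R) t :
  pseries (fun i => a * b i) t = series (a *: (fun i => b i * t ^+ i)).
Proof. by apply/funext => S; apply: eq_bigr => i _ /=; rewrite -mulrA. Qed.

Lemma converges_within_scale (a : R) (b : nat -> R) :
  converges_within b rho -> converges_within (fun i => a * b i) rho.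
Proof. by move=> cvgb t /cvgb H; rewrite pseries_scale; exact: is_cvg_seriesZ. Qed.

Lemma psum_scale (a : R) (b : nat -> R) t : converges_within b rho -> `|t| < rho ->
  psum (fun i => a * b i) t = a * psum b t.
Proof. by move=> cvgb /cvgb H; rewrite /psum pseries_scale lim_seriesZ. Qed.

Lemma is_derive_psum_hasse j t : `|t| < rho ->
  is_derive t (1 : R) (psum (hasse c j)) (j.+1%:R * psum (hasse c j.+1) t).
Proof.
move=> trho; pose K := (`|t| + rho) / 2.
have t0 := normr_ge0 t.
have K0 : 0 <= K by rewrite /K; lra.
have tK : `|t| < `|K| by rewrite (ger0_norm K0) /K; lra.
have Krho : `|K| < rho by rewrite (ger0_norm K0) /K; lra.
have cvgj := hasse_within (j := j) cvgc.
have cvgSj := converges_within_scale (a := j.+1%:R) (hasse_within (j := j.+1) cvgc).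
rewrite -psum_scale//; last exact: hasse_within.
rewrite -pseries_diffs_hasse; apply: (@pseries_snd_diffs _ _ K) => //.
- exact: cvgj.
- by rewrite pseries_diffs_hasse; exact: cvgSj.
- rewrite pseries_diffs_hasse (_ : pseries_diffs _ =
    fun i => j.+1%:R * (j.+2%:R * hasse c j.+2 i)).
    apply: (converges_within_scale _ Krho).
    exact: (converges_within_scale (hasse_within (j := j.+2) cvgc)).
  apply/funext => i; rewrite /pseries_diffs mulrCA; congr (_ * _).
  by have := congr1 (fun h => h i) (pseries_diffs_hasse j.+1).
Qed.

(** The derivatives of the even extension of the power series. *)
(** The j-th derivative of f|t|, glued from the two sides of 0. *)
Definition even_derivative j (t : R) : R :=
  if 0 <= t then j`!%:R * psum (hasse c j) t
  else (-1) ^+ j * (j`!%:R * psum (hasse c j) (- t)).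

Variable (q : nat).
Hypothesis (codd : forall s, odd s -> (s < q)%N -> c s = 0).

(** At 0 the one-sided values and derivatives agree as long as the Taylor
    coefficients of odd index that occur vanish. *)
Lemma is_derive_even_derivative j t : (j.+1 < q)%N -> `|t| < rho ->
  is_derive t (1 : R) (even_derivative j) (even_derivative j.+1 t).
Proof.
move=> jq trho.
pose D k t := k`!%:R * psum (hasse c k) t.
have Dder s : `|s| < rho -> is_derive s (1 : R) (D j) (D j.+1 s).
  move=> srho; rewrite /D factS natrM [_%:R * _]mulrC -mulrA.
  by apply: is_deriveZ; exact: is_derive_psum_hasse.
have Dneg s : `|s| < rho ->
    is_derive s (1 : R) (fun s => (-1) ^+ j * D j (- s)) ((-1) ^+ j.+1 * D j.+1 (- s)).
  move=> srho; rewrite exprSr -mulrA mulN1r; apply: is_deriveZ.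
  have -> : (fun s => D j (- s)) = (fun s => D j (0 - s)).
    by apply/funext => v; rewrite sub0r.
  apply: (@is_derive_reflect (D j)).
  by rewrite sub0r; apply: Dder; rewrite normrN.
have neg0 k : (k < q)%N -> (-1) ^+ k * D k (- 0) = D k 0.
  move=> kq; rewrite oppr0 /D psum_hasse0; have [ok|ek] := boolP (odd k).
    by rewrite codd// !mulr0.
  by rewrite -signr_odd (negbTE ek) mul1r.
have [t0|t0|t0] := ltgtP t 0.
- have E : even_derivative j.+1 t = (-1) ^+ j.+1 * D j.+1 (- t).
    by rewrite /even_derivative leNgt t0.
  rewrite E; apply: near_eq_is_derive (Dneg _ trho).
  near=> s; have s0 : s < 0 by near: s; exact: lt_nbhsl.
  by rewrite /even_derivative leNgt s0.
- have E : even_derivative j.+1 t = D j.+1 t by rewrite /even_derivative ltW.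
  rewrite E; apply: near_eq_is_derive (Dder _ trho).
  near=> s; have s0 : 0 < s by near: s; exact: lt_nbhsr.
  by rewrite /even_derivative ltW.
- rewrite t0 in trho *.
  have E : even_derivative j.+1 0 = D j.+1 0 by rewrite /even_derivative lexx.
  rewrite E; apply: (@is_derive_glue _ (D j) (fun s => (-1) ^+ j * D j (- s))).
  + by move=> s s0; rewrite /even_derivative s0.
  + move=> s; rewrite /even_derivative le_eqVlt => /orP[/eqP->|s0].
      by rewrite lexx neg0// ltnW.
    by rewrite leNgt s0.
  + exact: Dder.
  + by rewrite -neg0//; exact: Dneg.
Unshelve. all: by end_near. Qed.

End WronskianDerivatives.

Lemma wronskianE (R : realType) (kappa : R -> R -> R) (f : R -> R)
    (c : nat -> R) (rho : R) (l : nat) :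
  stationary kappa f -> 0 < rho -> converges_within c rho ->
  (forall t, `|t| < rho -> f t = psum c t) ->
  (forall s, odd s -> (s < 2 * l + 1)%N -> c s = 0) ->
  wronskian kappa l = flat_wronskian c l.+1.
Proof.
move=> stat rho0 cvgc fE codd; apply/matrixP => i j; rewrite !mxE.
have hasse0 : hasse c 0 = c.
  by apply/funext => k; rewrite /hasse addn0 bin0 mulr1.
have g0 t : `|t| < rho -> f `|t| = even_derivative c 0 t.
  move=> trho; rewrite fE ?normr_id// /even_derivative hasse0 !mul1r.
  by case: ifP => [t0|/negbT]; [rewrite ger0_norm|rewrite -ltNge => t0; rewrite ltr0_norm].
have il := ltn_ord i; have jl := ltn_ord j.
have inner a : `|a| < rho -> derive1n j (kappa a) 0 = (-1) ^+ j * even_derivative c j a.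
  move=> arho.
  rewrite -[X in even_derivative c j X]subr0.
  apply: (@derive1n_family R (kappa a)
    (fun k y => (-1) ^+ k * even_derivative c k (a - y)) (rho - `|a|) j) => //.
  - move=> t trho; rewrite stat expr0 mul1r g0// (le_lt_trans (ler_normB _ _))//; lra.
  - move=> k t kj trho; rewrite exprSr -mulrA mulN1r; apply: is_deriveZ.
    apply: is_derive_reflect.
    apply: (is_derive_even_derivative cvgc codd); first by lia.
    by rewrite (le_lt_trans (ler_normB _ _))//; lra.
  - by rewrite normr0 subr_gt0.
have -> : derive1n i (fun a => derive1n j (kappa a) 0) 0 =
    (-1) ^+ j * even_derivative c (j + i) 0.
  apply: (@derive1n_family R (fun a => derive1n j (kappa a) 0)
    (fun k a => (-1) ^+ j * even_derivative c (j + k) a) rho i); rewrite ?normr0//.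
  - by move=> t trho; rewrite addn0 inner.
  - move=> k t ki trho; rewrite addnS; apply: is_deriveZ.
    by apply: (is_derive_even_derivative cvgc codd) => //; lia.
rewrite /even_derivative lexx psum_hasse0 /hasse addnC.
have F n : (n`!%:R : R) != 0 by rewrite pnatr_eq0 -lt0n fact_gt0.
by rewrite bin_ratio; field; rewrite !F.
Qed.

(** * Values of the bordered determinants *)

Section SaddleValues.
Context {R : realType}.

(** Fewer points than polynomials: some combination of the border columns is zero. *)
Lemma saddle_small m q (L : 'M[R]_m) (V : 'M[R]_(m, q)) : (m < q)%N -> saddle L V = 0.
Proof.
move=> mq; rewrite /saddle; set A := block_mx _ _ _ _.
suff -> : \det A = 0 by rewrite mulr0.
have : kermx V^T != 0.
  by rewrite -mxrank_eq0 mxrank_ker subn_eq0 -ltnNge (leq_ltn_trans (rank_leq_col _)).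
move=> /rowV0Pn[v /sub_kermxP vV v0]; apply/eqP/det0P; exists (row_mx 0 v).
  by apply: contra v0 => /eqP E; rewrite -(row_mxKr (0 : 'rV[R]_m) v) E linear0.
by rewrite mul_row_block !mul0mx mulmx0 vV !addr0 row_mx0.
Qed.

Lemma saddle_square m q (y : 'I_m -> R) (L : 'M[R]_m) : injective y -> m = q ->
  saddle L (vander y q) = \det (vander y m) ^+ 2.
Proof.
move=> yinj mq; have [d mE d0] : exists2 d, m = (q + d)%N & d = 0%N.
  by exists 0%N; rewrite ?addn0.
by clear mq; subst m; subst d; rewrite saddle_vander// det_mx00 mulr1.
Qed.

Lemma det_vander_gram m q (y : 'I_m -> R) : m = q ->
  \det (vander y q *m (vander y q)^T) = \det (vander y m) ^+ 2.
Proof. by move=> mq; subst q; rewrite det_mulmx (det_tr (vander y m)). Qed.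

Lemma saddle_scale m q d (y : 'I_m -> R) (L : 'M[R]_m) (a : R) : injective y ->
  m = (q + d)%N -> saddle (a *: L) (vander y q) = a ^+ d * saddle L (vander y q).
Proof.
move=> yinj mE; subst m; rewrite !saddle_vander// mulrCA; congr (_ * _).
rewrite -scalemxAr -scalemxAl -detZ; congr (\det _).
by apply/matrixP => i j; rewrite !mxE.
Qed.

Lemma saddle_rank_one m q d (y : 'I_m -> R) (b : R) : injective y -> m = (q + d)%N ->
  saddle (b *: (vcol y q.+1 *m (vcol y q.+1)^T)) (vander y q) =
  if (d <= 1)%N then b ^+ d * \det (vander y m) ^+ 2 else 0.
Proof.
move=> yinj mE; subst m; rewrite saddle_vander// mulrC.
set Ui := invmx _; set N := drsubmx _.
have NE i j : N i j = b * (i == 0 :> nat)%:R * (j == 0 :> nat)%:R.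
  have q_lt : (q < q + d)%N by rewrite -[X in (X < _)%N]addn0 ltn_add2l (leq_ltn_trans _ (ltn_ord i)).
  have Uv (k : 'I_d) : (Ui *m vcol y q.+1) (rshift q k) 0 = (k == 0 :> nat)%:R.
    have := moment_dual (rshift q k) yinj q_lt.
    rewrite /moment mxE /= -[X in X == _]addn0 eqn_add2l eq_sym => <-.
    by apply: eq_bigr => l _; rewrite [vcol _ _ _ _]mxE subn1.
  have NN v : Ui *m (b *: (v *m v^T)) *m Ui^T = b *: ((Ui *m v) *m (Ui *m v)^T).
    by rewrite trmx_mul -scalemxAr -scalemxAl !mulmxA.
  have wE (w : 'cV[R]_(q + d)) :
      drsubmx (b *: (w *m w^T)) i j = b * w (rshift q i) 0 * w (rshift q j) 0.
    by rewrite !mxE big_ord1 !mxE mulrA.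
  by rewrite /N NN wE !Uv.
case: ifP => [d1|/negbT]; last rewrite -ltnNge => d2.
  congr (_ * _); move: d1; case: (d) (N) (NE) => [|[|//]] N' NE' _.
    by rewrite det_mx00.
  by rewrite [N']mx11_scalar det_scalar NE' !mulr1.
suff -> : \det N = 0 by rewrite mul0r.
apply/eqP/det0P; exists (delta_mx 0 (Ordinal d2)).
  by apply/eqP => /rowP/(_ (Ordinal d2))/eqP; rewrite !mxE !eqxx oner_eq0.
by rewrite -rowE; apply/rowP => j; rewrite [LHS]mxE NE mulr0 mul0r mxE.
Qed.

Lemma rank_vander m q (y : 'I_m -> R) : injective y -> (q <= m)%N ->
  \rank (vander y q) = q.
Proof.
move=> yinj qm; rewrite -mxrank_tr; apply/eqP; rewrite -/(row_free _).
apply/row_freeP; exists (\matrix_(i, a) invmx (vander y m) (widen_ord qm a) i).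
apply/matrixP => k a; rewrite mxE [RHS]mxE.
have := moment_dual (widen_ord qm a) yinj (leq_trans (ltn_ord k) qm).
rewrite /moment /= => H; rewrite -[RHS]H.
by apply: eq_bigr => i _; rewrite !mxE mulrC.
Qed.

Lemma moment_vander m q (y : 'I_m -> R) (u : 'cV[R]_m) :
  (vander y q)^T *m u = 0 -> forall k, (k < q)%N -> moment y (u^~ 0) k = 0.
Proof.
move=> Vu k kq; have := congr1 (fun M : 'cV[R]_q => M (Ordinal kq) 0) Vu.
rewrite !mxE => <-; apply: eq_bigr => i _.
by rewrite !mxE mulrC.
Qed.

End SaddleValues.

(** * Optimal sizes *)

Section Sizes.
Variables (inc : nat -> nat) (p : nat).

Definition size_cost m := (\sum_(a < m) inc a)%N.

(** Minimality of [size_cost m - p * m] among the sizes up to n, without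
    subtraction. *)
Definition optimal_size n m :=
  [forall m' : 'I_n.+1, (size_cost m + p * m' <= size_cost m' + p * m)%N].

Lemma size_costS m : size_cost m.+1 = (size_cost m + inc m)%N.
Proof. by rewrite /size_cost big_ord_recr. Qed.

Lemma cost_up m d : (forall a, (m <= a < m + d)%N -> (p <= inc a)%N) ->
  (size_cost m + p * (m + d) <= size_cost (m + d) + p * m)%N.
Proof.
elim: d => [|d IH] H; first by rewrite addn0.
have /IH : forall a, (m <= a < m + d)%N -> (p <= inc a)%N by move=> a ad; apply: H; lia.
have := H (m + d)%N; rewrite addnS size_costS; lia.
Qed.

Lemma cost_down m d : (forall a, (m <= a < m + d)%N -> (inc a <= p)%N) ->
  (size_cost (m + d) + p * m <= size_cost m + p * (m + d))%N.
Proof.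
elim: d => [|d IH] H; first by rewrite addn0.
have /IH : forall a, (m <= a < m + d)%N -> (inc a <= p)%N by move=> a ad; apply: H; lia.
have := H (m + d)%N; rewrite addnS size_costS; lia.
Qed.

Lemma optimal_sizeE n lo hi : (lo <= hi <= n)%N ->
  (forall a, (a < lo)%N -> (inc a < p)%N) ->
  (forall a, (lo <= a < hi)%N -> inc a = p) ->
  (forall a, (hi <= a < n)%N -> (p < inc a)%N) ->
  forall m, (m <= n)%N -> optimal_size n m = (lo <= m <= hi)%N.
Proof.
move=> /andP[lohi hin] H1 H2 H3 m mn.
have up a b : (lo <= a <= b)%N -> (b <= n)%N ->
    (size_cost a + p * b <= size_cost b + p * a)%N.
  move=> /andP[la ab] bn; rewrite -(subnKC ab); apply: cost_up => k /andP[ak kb].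
  have [kh|hk] := ltnP k hi; first by rewrite H2//; lia.
  by apply: ltnW; apply: H3; lia.
have down a b : (a <= b <= hi)%N -> (size_cost b + p * a <= size_cost a + p * b)%N.
  move=> /andP[ab bh]; rewrite -(subnKC ab); apply: cost_down => k /andP[ak kb].
  have [kl|lk] := ltnP k lo; first by apply: ltnW; apply: H1.
  by rewrite H2//; lia.
apply/forallP/idP => [opt|/andP[lom mhi] m']; last first.
  have := ltn_ord m'; have [mm'|/ltnW m'm] := leqP m m' => ?.
    by apply: up; lia.
  by apply: down; lia.
rewrite leqNgt [(m <= hi)%N]leqNgt; apply/andP; split; apply/negP => bad.
  have lon : (lo < n.+1)%N by lia.
  have := opt (Ordinal lon); have := down m.+1 lo.
  by have := H1 m bad; rewrite size_costS /=; lia.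
have hin' : (hi < n.+1)%N by lia.
have := opt (Ordinal hin'); have := up hi m.-1.
have mE : m = m.-1.+1 by lia.
by have := H3 m.-1; rewrite mE size_costS /=; lia.
Qed.

Lemma optimal_size_exists n : exists2 m, (m <= n)%N & optimal_size n m.
Proof.
pose cost (m : 'I_n.+1) := (size_cost m + p * (n - m))%N.
have [m _ mmin] := @arg_minnP _ (ord0 : 'I_n.+1) xpredT cost isT.
exists m; first by rewrite -ltnS.
apply/forallP => m'; have := mmin m' isT; rewrite /cost.
have := ltn_ord m; have := ltn_ord m'.
by rewrite !ltnS => h1 h2; rewrite !mulnBr; nia.
Qed.

End Sizes.

(** * Limits of normalized weights *)

Section LimitLaw.
Context {R : realType}.

(** Since the empty set has weight 1, the normalizing constants and all weights are
    nonnegative; hence the limits om are nonnegative and one nonzero value suffices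
    for their sum to be positive. *)
Lemma cvg_law n (P w : R -> {set 'I_n} -> R) (t : R -> R) (om : {set 'I_n} -> R) :
  (forall eps, 0 < eps -> law_propto (P eps) (w eps)) ->
  (forall eps, 0 < eps -> w eps finset.set0 = 1) ->
  (forall eps, 0 < eps -> 0 < t eps) ->
  (forall X, t eps * w eps X @[eps --> 0^'+] --> om X) ->
  (exists X, om X != 0) ->
  is_law (fun X => om X / \sum_Y om Y) /\
  forall X, P eps X @[eps --> 0^'+] --> om X / \sum_Y om Y.
Proof.
move=> Pw w0 t0 tw [X0 omX0].
have wge0 eps X : 0 < eps -> 0 <= w eps X.
  move=> eps0; have [[Pge0 P1] [a Pa]] := Pw eps eps0.
  have a0 : 0 <= a by have := Pge0 finset.set0; rewrite Pa w0// mulr1.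
  have a1 : a != 0.
    apply/eqP => az; have := oner_neq0 R; rewrite -P1 big1 ?eqxx// => Y _.
    by rewrite Pa az mul0r.
  by have := Pge0 X; rewrite Pa pmulr_rge0// lt_neqAle eq_sym a1.
have om0 X : 0 <= om X.
  apply: (cvgr_to_ge (tw X)); near=> eps.
  have eps0 : 0 < eps by near: eps; exact: nbhs_right_gt.
  by rewrite mulr_ge0 ?wge0// ltW ?t0.
have S0 : 0 < \sum_Y om Y.
  have omX0' : 0 < om X0 by rewrite lt_neqAle eq_sym omX0 om0.
  by rewrite (bigD1 X0)//= ltr_pwDl// sumr_ge0.
split.
  split=> [X|]; first by rewrite divr_ge0 ?om0// ltW.
  by rewrite -mulr_suml divff// gt_eqF.
move=> X.
have H : ((t eps * w eps X) / \sum_Y t eps * w eps Y) @[eps --> 0^'+] -->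
    om X / \sum_Y om Y.
  apply: cvgM; first exact: tw.
  apply: cvgV; first by rewrite gt_eqF.
  by apply: cvg_big => //; exact: add_continuous.
apply: cvg_trans H; apply: near_eq_cvg; near=> eps.
have eps0 : 0 < eps by near: eps; exact: nbhs_right_gt.
have [[_ P1] [a Pa]] := Pw eps eps0.
have aw : a * \sum_Y w eps Y = 1.
  by rewrite mulr_sumr -P1; apply: eq_bigr => Y _; rewrite Pa.
have Sw : \sum_Y w eps Y != 0.
  by apply/eqP => Sw0; move: aw; rewrite Sw0 mulr0 => /esym/eqP; rewrite oner_eq0.
rewrite Pa -mulr_sumr; have -> : a = (\sum_Y w eps Y)^-1 by apply: (mulIf Sw); rewrite aw mulVf.
by field; rewrite Sw gt_eqF// t0.
Unshelve. all: by end_near. Qed.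

Lemma cvg_expr_at_right0 e : (eps ^+ e) @[eps --> (0 : R)^'+] --> ((e == 0)%:R : R).
Proof.
by case: e => [|e]; [exact: cvg_cst|exact: cvg_exprS_at_right0].
Qed.

Definition nodes n (x : 'I_n -> R) (X : {set 'I_n}) (i : 'I_#|X|) : R :=
  x (enum_val i).

Lemma nodes_inj n (x : 'I_n -> R) X : injective x -> injective (nodes x (X := X)).
Proof. by move=> xinj i j /xinj /enum_val_inj. Qed.

Lemma det_prin_kernel n (x : 'I_n -> R) (f : R -> R) (a eps : R) X :
  \det (prin_submx (a *: kernel_mx f x eps) X) =
  a ^+ #|X| * \det (kernel_mx f (nodes x (X := X)) eps).
Proof. by rewrite -detZ; congr (\det _); apply/matrixP => i j; rewrite !mxE. Qed.

Lemma det_size0 m (A : 'M[R]_m) : m = 0%N -> \det A = 1.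
Proof. by move=> m0; subst m; rewrite det_mx00. Qed.

Lemma prin_dist n (x : 'I_n -> R) (a : R) s X :
  prin_submx (a *: dist_mx x s) X = a *: dist_mx (nodes x (X := X)) s.
Proof. by apply/matrixP => i j; rewrite !mxE. Qed.

Lemma prin_rank_one n (x : 'I_n -> R) (a : R) s X :
  prin_submx (a *: (vcol x s *m (vcol x s)^T)) X =
  a *: (vcol (nodes x (X := X)) s *m (vcol (nodes x (X := X)) s)^T).
Proof.
by apply/matrixP => i j; rewrite !mxE; congr (_ * _); apply: eq_bigr => k _; rewrite !mxE.
Qed.

Lemma prin_gram n (x : 'I_n -> R) q X :
  prin_submx (vander x q *m (vander x q)^T) X =
  vander (nodes x (X := X)) q *m (vander (nodes x (X := X)) q)^T.
Proof.
by apply/matrixP => i j; rewrite !mxE; apply: eq_bigr => k _; rewrite !mxE.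
Qed.

Lemma row_vander n (x : 'I_n -> R) q X :
  row_submx (vander x q) X = vander (nodes x (X := X)) q.
Proof. by apply/matrixP => i j; rewrite !mxE. Qed.

End LimitLaw.

(** * The limit law *)

Section SmoothnessOrder.
Context {R : realType}.

Definition below_order (r : option nat) q := if r is Some k then (q <= k)%N else true.
(** The size of the Wronskian block for m points. *)
Definition capped (r : option nat) m := if r is Some k then minn m k else m.
(** The increment of [flat_exponent] when an (a+1)-st point is added. It does not
    depend on the total number of points although [capped] does, which makes the
    cost of a size a plain sum. *)
Definition exponent_step (r : option nat) a :=
  if r is Some k then (minn a k + minn a k.-1)%N else (a + a)%N.

Variables (f : R -> R) (r : option nat).
Hypothesis f_order : smoothness_order f r.

Lemma odd_coef0 q s : below_order r q -> odd s -> (s < 2 * q - 1)%N -> taylor_coef f s = 0.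
Proof.
move=> rq os sq; have sE : s = (2 * (s.+1)./2 - 1)%N by lia.
have s1 : (1 <= (s.+1)./2)%N by lia.
case: r f_order rq => [k [_ _ kmin] /= qk|/(_ _ s1)]; last by rewrite -sE.
apply/eqP/negPn/negP; rewrite sE => /(kmin _ s1); lia.
Qed.

Lemma exponent_step_small q a : below_order r q -> (a < q)%N ->
  exponent_step r a = (2 * a)%N.
Proof. by rewrite /exponent_step; case: r => [k|] /=; lia. Qed.

Lemma exponent_step_large q a : below_order r q -> (q <= a)%N ->
  (2 * q - 1 <= exponent_step r a)%N.
Proof. by rewrite /exponent_step; case: r => [k|] /=; lia. Qed.

Lemma capped_id m : below_order r m -> capped r m = m.
Proof. by case: r => //= k /minn_idPl. Qed.

End SmoothnessOrder.

Section FlatLimit.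
Context {R : realType}.
Variables (n : nat) (x : 'I_n -> R) (kappa : R -> R -> R) (f : R -> R) (r : option nat).
Hypotheses (x_inj : injective x)
  (kappa_pd : posdef_kernel kappa) (kappa_stat : stationary kappa f)
  (f_order : smoothness_order f r).
Let c := taylor_coef f.
Variable (rho : R).
Hypotheses (rho0 : 0 < rho) (cvgc : converges_within c rho)
  (fE : forall t, `|t| < rho -> f t = psum c t).

Lemma flat_wronskian_posdef q : below_order r q -> posdefmx (flat_wronskian c q).
Proof.
move=> rq; case: r f_order rq (odd_coef0 f_order) => [k|] fo rq codd.
  have [k1 ck _] := fo.
  apply: (flat_wronskian_posdef_finite kappa_pd kappa_stat rho0 cvgc fE rq) => // s.
  by apply: codd => /=.
apply: (flat_wronskian_posdef_infinite kappa_pd kappa_stat rho0 cvgc fE) => s os.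
by apply: (codd s.+1) => //; lia.
Qed.

Lemma below_capped m : below_order r (capped r m).
Proof. by case: r => //= k; exact: geq_minr. Qed.

Lemma flat_exponent_capped m :
  flat_exponent (capped r m) m = size_cost (exponent_step r) m.
Proof.
apply: eq_bigr => a _; have := ltn_ord a.
by rewrite /capped /exponent_step; case: r => [k|]; lia.
Qed.

Definition flat_weight (X : {set 'I_n}) : R :=
  let q := capped r #|X| in
  \det (flat_wronskian c q) *
    saddle (c (2 * q - 1) *: dist_mx (nodes x (X := X)) (2 * q - 1))
      (vander (nodes x (X := X)) q).

Lemma saddle_distance_neq0 m q (y : 'I_m -> R) : injective y ->
  (q <= m)%N -> ((q < m)%N -> [/\ below_order r q, (0 < q)%N & c (2 * q - 1) != 0]) ->
  saddle (c (2 * q - 1) *: dist_mx y (2 * q - 1)) (vander y q) != 0.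
Proof.
move=> yinj qm.
have [mq|mq] := ltnP q m; last first.
  by move=> _; rewrite saddle_square; [|by []|lia];
    rewrite expf_neq0// -unitfE -unitmxE; exact: vander_unit.
move/(_ isT) => [rq q0 cq].
  have [d mE] : exists d, m = (q + d)%N by exists (m - q)%N; rewrite subnKC.
  clear qm mq; subst m; rewrite saddle_vander//.
  have Uu := vander_unit yinj.
  rewrite mulf_neq0 ?expf_neq0 -?unitfE -?unitmxE// unitmxE unitfE.
  set Ui := invmx _ in Uu *; set N := _ *m _ *m _; apply/det0P => -[v v0 vN].
  pose A : 'rV[R]_(q + d) := row_mx 0 v *m Ui.
  have Am k : (k < q)%N -> moment y (A 0) k = 0.
    move=> kq; have kqd : (k < q + d)%N by exact: ltn_addr.
    have -> : moment y (A 0) k = (A *m vander y (q + d)) 0 (Ordinal kqd).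
      by rewrite mxE; apply: eq_bigr => i _; rewrite vanderE.
    rewrite /A mulmxKV//.
    have -> : Ordinal kqd = lshift d (Ordinal kq) by exact: val_inj.
    by rewrite row_mxEl mxE.
  have Anull : \sum_i \sum_j A 0 i * A 0 j * `|y i - y j| ^+ (2 * q - 1) = 0.
    apply: (mulfI cq); rewrite mulr0.
    transitivity ((row_mx 0 v *m N *m (row_mx 0 v)^T) 0 0).
      rewrite /N !mulmxA -/A -[A *m _ *m _ *m _]mulmxA -trmx_mul -/A congr_entry.
      rewrite (pair_bigA _ (fun i j => A 0 i * A 0 j * `|y i - y j| ^+ (2 * q - 1))).
      by rewrite mulr_sumr; apply: eq_bigr => ij _; rewrite !mxE mulrCA.
    rewrite -[N]submxK mul_row_block vN !mul0mx !add0r tr_row_mx mul_row_col.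
    by rewrite mul0mx addr0 trmx0 mulmx0 mxE.
  have Az := distance_form_definite kappa_pd kappa_stat rho0 cvgc fE q0
    (fun s os sq => odd_coef0 f_order rq os sq) yinj cq Am Anull.
  have : A *m vander y (q + d) = 0.
    by rewrite (_ : A = 0) ?mul0mx//; apply/rowP => i; rewrite Az mxE.
  rewrite /A mulmxKV// => E; move/eqP: v0; apply.
  by rewrite -(row_mxKr (0 : 'rV[R]_q) v) E linear0.
Qed.

Lemma flat_weight_neq0 (X : {set 'I_n}) : flat_weight X != 0.
Proof.
rewrite /flat_weight mulf_neq0 ?posdefmx_det_neq0//.
  by apply: flat_wronskian_posdef; exact: below_capped.
apply: saddle_distance_neq0.
- exact: nodes_inj.
- by rewrite /capped; case: r => // k; exact: geq_minl.
- have := below_capped #|X|; rewrite /capped; case: r f_order => [k [k1 ck _]|_] /=.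
    rewrite /minn; case: ifP => _; first by rewrite ltnn.
    by split.
  by rewrite ltnn.
Qed.

(** After multiplication by eps^(p m0) / eps^(cost of m0), for an optimal size m0, the
    weights of all optimal sizes converge to their leading coefficients and the
    others to 0. *)
Lemma flat_limit (p : nat) (alpha : R) (P : R -> {set 'I_n} -> R) : 0 < alpha ->
  (forall eps : R, 0 < eps ->
     is_DPP (P eps) ((alpha * eps ^- p) *: kernel_mx f x eps)) ->
  exists (Pstar : {set 'I_n} -> R) (K : R),
  [/\ is_law Pstar,
      forall X, P eps X @[eps --> 0^'+] --> Pstar X &
      forall X : {set 'I_n}, Pstar X = K *
        (if optimal_size (exponent_step r) p n #|X|
         then alpha ^+ #|X| * flat_weight X else 0)].
Proof.
move=> alpha_gt0 P_DPP; have [m0 m0n opt0] := optimal_size_exists (exponent_step r) p n.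
pose s := size_cost (exponent_step r).
pose t (eps : R) := eps ^+ (p * m0) / eps ^+ s m0.
pose om (X : {set 'I_n}) := if optimal_size (exponent_step r) p n #|X|
         then alpha ^+ #|X| * flat_weight X else 0.
pose w eps (X : {set 'I_n}) := \det (prin_submx ((alpha * eps ^- p) *: kernel_mx f x eps) X).
have card_le (X : {set 'I_n}) : (#|X| <= n)%N by rewrite -[X in (_ <= X)%N]card_ord max_card.
have [] := @cvg_law R n P w t om.
- by move=> eps eps0; case: (P_DPP _ eps0).
- by move=> eps eps0; rewrite /w det_prin_kernel det_size0 ?cards0// mulr1.
- by move=> eps eps0; rewrite divr_gt0 ?exprn_gt0.
- move=> X; pose e := (s #|X| + p * m0 - (s m0 + p * #|X|))%N.
  have le0 : (s m0 + p * #|X| <= s #|X| + p * m0)%N.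
    have X_lt : (#|X| < n.+1)%N by rewrite ltnS.
    by have /forallP/(_ (Ordinal X_lt)) := opt0.
  have optE : optimal_size (exponent_step r) p n #|X| = (e == 0).
    rewrite /e subn_eq0; apply/forallP/idP => [|le1 m'].
      have m0_lt : (m0 < n.+1)%N by rewrite ltnS.
      by move/(_ (Ordinal m0_lt)).
    by have /forallP/(_ m') := opt0; move: le1; rewrite /s; lia.
  have H : (alpha ^+ #|X| * eps ^+ e *
     (\det (kernel_mx f (nodes x (X := X)) eps) / eps ^+ s #|X|)) @[eps --> 0^'+] --> om X.
    have -> : om X = alpha ^+ #|X| * (e == 0)%:R * flat_weight X.
      by rewrite /om optE; case: eqP; rewrite ?mulr1// mulr0 mul0r.
    apply: cvgM.
      by apply: cvgM; [exact: cvg_cst|exact: cvg_expr_at_right0].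
    rewrite /s -flat_exponent_capped.
    apply: (det_kernel_cvg rho0 cvgc fE); first exact: nodes_inj.
      by rewrite /capped; case: r => // k; exact: geq_minl.
    by move=> i; apply: (odd_coef0 f_order); exact: below_capped.
  apply: cvg_trans H; apply: near_eq_cvg; near=> eps.
  have eps0 : eps != 0 by near: eps; exact: nbhs_right_neq.
  rewrite /w det_prin_kernel exprMn /t exprVn -exprM.
  have -> : eps ^+ e = eps ^+ s #|X| * eps ^+ (p * m0) /
      (eps ^+ s m0 * eps ^+ (p * #|X|)).
    by apply: (canRL (mulfK _)); rewrite ?mulf_neq0 ?expf_neq0// -!exprD subnK.
  by field; rewrite !expf_neq0.
- exists [set widen_ord m0n i | i in 'I_m0]%SET.
  rewrite /om card_imset; last by move=> i j /(congr1 val)/= /val_inj.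
  by rewrite card_ord opt0 mulf_neq0 ?flat_weight_neq0// expf_neq0// gt_eqF.
move=> law cv; exists (fun X => om X / \sum_Y om Y), (\sum_Y om Y)^-1.
by split=> // X; rewrite mulrC.
Unshelve. all: by end_near. Qed.

End FlatLimit.

(** * The regimes of the theorem *)

Lemma qform_inv_gt0 (R : realType) m (A : 'M[R]_m.+1) i : posdefmx A ->
  0 < invmx A i i.
Proof.
move=> Apos; have Au : A \in unitmx by rewrite unitmxE unitfE posdefmx_det_neq0.
have [Asym Agt0] := Apos.
pose u : 'cV[R]_m.+1 := invmx A *m delta_mx i 0.
have Au1 : A *m u = delta_mx i 0 by rewrite /u mulKVmx.
have u0 : u != 0.
  apply/eqP => u0; move: Au1; rewrite u0 mulmx0 => /colP/(_ i)/eqP.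
  by rewrite !mxE !eqxx eq_sym oner_eq0.
have := Agt0 u u0; rewrite /qform -mulmxA Au1 -colE mxE mxE.
by rewrite /u -colE mxE.
Qed.

Lemma gram_form_ge0 (R : realType) m q (B : 'M[R]_(m, q)) (u : 'cV[R]_m) :
  0 <= qform (B *m B^T) u.
Proof.
rewrite /qform mulmxA -mulmxA -[u^T *m B]trmxK trmx_mul trmxK mxE.
by apply: sumr_ge0 => k _; rewrite mxE -expr2 sqr_ge0.
Qed.

Lemma inv_corner (R : realType) (c : nat -> R) l : \det (flat_wronskian c l.+1) != 0 ->
  invmx (flat_wronskian c l.+1) ord_max ord_max =
  \det (flat_wronskian c l) / \det (flat_wronskian c l.+1).
Proof.
move=> W0; rewrite /invmx unitmxE unitfE W0 mxE mxE /cofactor mulrC.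
rewrite -signr_odd oddD addbb expr0 mul1r; congr (\det _ / _).
apply/matrixP => i j; rewrite !mxE.
have E (k : 'I_l) : lift ord_max k = k :> nat.
  by rewrite /= /bump leqNgt ltn_ord add0n.
by rewrite !E.
Qed.


Section Regimes.
Context {R : realType}.
Variables (n p : nat) (alpha : R) (x : 'I_n -> R) (f : R -> R) (r : option nat).
Hypothesis x_inj : injective x.
Let c := taylor_coef f.
Variables (Pstar : {set 'I_n} -> R) (K : R).
Hypotheses (law : is_law Pstar)
  (PstarE : forall X : {set 'I_n}, Pstar X = K *
     (if optimal_size (exponent_step r) p n #|X|
      then alpha ^+ #|X| * flat_weight x f r X else 0)).

Let card_le (X : {set 'I_n}) : (#|X| <= n)%N.
Proof. by rewrite -[X in (_ <= X)%N]card_ord max_card. Qed.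

(** Every additional point lowers the order of the weight. *)
Lemma full_limit : (forall a, (a < n)%N -> (exponent_step r a < p)%N) ->
  Pstar [set: 'I_n]%SET = 1.
Proof.
move=> step_lt; case: law => _; rewrite (bigD1 [set: 'I_n]%SET)//= big1 ?addr0// => X XT.
rewrite PstarE (optimal_sizeE (lo := n) (hi := n)) ?leqnn//; last 2 first.
- by move=> a /andP[]; case: ltngtP.
- by move=> a /andP[]; case: ltngtP.
case: ifP => [/andP[nX _]|]; last by rewrite mulr0.
by case/negP: XT; rewrite finset.eqEcard finset.subsetT cardsT card_ord.
Qed.

(** On the single optimal size l the bordered determinant is the squared
    Vandermonde determinant. *)
Lemma fixed_size_limit l : p = (2 * l - 1)%N -> (0 < l <= n)%N ->
  below_order r l.+1 ->
  is_fixed_size_DPP Pstar l (vander x l *m (vander x l)^T).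
Proof.
move=> pl /andP[l0 ln] rl1.
have rl : below_order r l by move: rl1; rewrite /below_order; case: r => // k /ltnW.
have optE X : optimal_size (exponent_step r) p n #|X : {set 'I_n}| = (#|X| == l).
  rewrite (optimal_sizeE (lo := l) (hi := l)) ?leqnn//.
  - by rewrite -eqn_leq eq_sym.
  - by move=> a al; rewrite (exponent_step_small rl al) pl; lia.
  - by move=> a /andP[la al]; move: (leq_ltn_trans la al); rewrite ltnn.
  - move=> a /andP[la _]; have [al|al] := ltnP a l.+1.
      by rewrite (exponent_step_small rl1 al) pl; lia.
    by have := exponent_step_large rl1 al; rewrite pl; lia.
split; first by split; [rewrite trmx_mul trmxK|exact: gram_form_ge0].
split=> //; exists (K * (alpha ^+ l * \det (flat_wronskian c l))) => X.
rewrite PstarE optE; case: eqP => [Xl|]; last by rewrite !mulr0.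
have cX : capped r #|X| = l by rewrite Xl capped_id.
rewrite /flat_weight cX saddle_square ?prin_gram//; last exact: nodes_inj.
rewrite det_vander_gram//; move: (\det (vander _ _) ^+ 2) => v.
by rewrite Xl -/c; ring.
Qed.

Variables (kappa : R -> R -> R) (rho : R).
Hypotheses (kappa_pd : posdef_kernel kappa) (kappa_stat : stationary kappa f)
  (f_order : smoothness_order f r) (rho0 : 0 < rho) (cvgc : converges_within c rho)
  (fE : forall t, `|t| < rho -> f t = psum c t).

Let W_pd q : below_order r q -> posdefmx (flat_wronskian c q).
Proof. exact: (flat_wronskian_posdef kappa_pd kappa_stat f_order rho0 cvgc fE). Qed.

(** Between the two optimal sizes l and l + 1 the leading coefficients change by the
    factor alpha det W_{l+1} / det W_l, up to squared Vandermonde determinants; by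
    Cramer's rule this factor is alpha / w. *)
Lemma rank_one_limit l : 0 < alpha -> p = (2 * l)%N -> (l < n)%N -> below_order r l.+1 ->
  let w := invmx (wronskian kappa l) ord_max ord_max in
  is_extended_DPP Pstar
    ((alpha / w) *: (vcol x l.+1 *m (vcol x l.+1)^T)) (vander x l).
Proof.
move=> alpha_gt0 pl ln rl1.
have rl : below_order r l by move: rl1; rewrite /below_order; case: r => // k /ltnW.
have optE X : optimal_size (exponent_step r) p n #|X : {set 'I_n}| =
    (l <= #|X| <= l.+1)%N.
  rewrite (optimal_sizeE (lo := l) (hi := l.+1)) ?leqnSn//.
  - by move=> a al; rewrite (exponent_step_small rl al) pl; lia.
  - by move=> a /andP[la al]; rewrite (exponent_step_small rl1 al) pl; lia.
  - by move=> a /andP[la _]; have := exponent_step_large rl1 la; rewrite pl; lia.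
rewrite (wronskianE kappa_stat rho0 cvgc fE); last first.
  by move=> s os sl; apply: (odd_coef0 f_order rl1 os); lia.
have w0 := qform_inv_gt0 ord_max (W_pd rl1).
have W1 := posdefmx_det_neq0 (W_pd rl1).
have W0 := posdefmx_det_neq0 (W_pd rl).
move: w0; rewrite inv_corner//; set w := _ / _ => w0; split.
- by rewrite linearZ/= trmx_mul trmxK.
- by rewrite rank_vander// ltnW.
- move=> u _; rewrite /qform -scalemxAr -scalemxAl mxE.
  apply: mulr_ge0; last exact: gram_form_ge0.
  by rewrite divr_ge0 ?ltW.
split=> //; exists (K * (alpha ^+ l * \det (flat_wronskian c l))) => X.
have yinj := nodes_inj (X := X) x_inj.
rewrite -/(saddle _ _) prin_rank_one row_vander PstarE optE.
have [Xl|lX] := ltnP #|X| l; first by rewrite saddle_small// !mulr0.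
have Xd : #|X| = (l + (#|X| - l))%N by rewrite subnKC.
rewrite (saddle_rank_one _ yinj Xd) andTb leq_subLR addn1.
case: ifP => Xl1; last by rewrite !mulr0.
have rX : below_order r #|X|.
  by move: rl1; rewrite /below_order; case: r => // k; exact: leq_trans.
rewrite /flat_weight capped_id// saddle_square//.
move: (\det (vander _ _) ^+ 2) => v; rewrite -/c.
move: Xl1; rewrite leq_eqVlt ltnS => /orP[/eqP ->|Xl].
  by rewrite subSnn expr1 exprS /w; field; rewrite W0 W1.
have -> : #|X| = l by apply/eqP; rewrite eqn_leq Xl.
by rewrite subnn expr0; ring.
Qed.

(** All sizes m >= k are optimal, and the bordered determinant is homogeneous of
    degree m - k, so that alpha^m splits into alpha^k and the scaling of the
    distance matrix by alpha. *)
Lemma distance_limit k : 0 < alpha -> r = Some k -> p = (2 * k - 1)%N -> (0 < k <= n)%N ->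
  is_extended_DPP Pstar
    ((alpha * taylor_coef f (2 * k - 1)) *: dist_mx x (2 * k - 1)) (vander x k).
Proof.
move=> alpha_gt0 rk pk /andP[k0 kn].
have rk0 : below_order r k by rewrite rk /=.
have optE X : optimal_size (exponent_step r) p n #|X : {set 'I_n}| = (k <= #|X|)%N.
  rewrite (optimal_sizeE (lo := k) (hi := n)) ?kn ?leqnn//.
  - by rewrite card_le andbT.
  - by move=> a ak; rewrite (exponent_step_small rk0 ak) pk; lia.
  - by move=> a /andP[ka _]; rewrite rk pk /exponent_step; lia.
  - by move=> a /andP[na an]; move: (leq_ltn_trans na an); rewrite ltnn.
split.
- by apply/matrixP => i j; rewrite !mxE distrC.
- exact: rank_vander.
- move=> u Vu.
  have := distance_form_ge0 kappa_pd kappa_stat rho0 cvgc fE k0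
    (fun s os sq => odd_coef0 f_order rk0 os sq) x_inj (moment_vander Vu).
  move=> /(mulr_ge0 (ltW alpha_gt0)) /le_trans; apply.
  rewrite qformE mulrA mulr_sumr le_eqVlt; apply/orP; left; apply/eqP.
  apply: eq_bigr => i _; rewrite mulr_sumr; apply: eq_bigr => j _.
  by rewrite !mxE /c; ring.
split=> //; exists (K * (alpha ^+ k * \det (flat_wronskian c k))) => X.
have yinj := nodes_inj (X := X) x_inj.
rewrite -/(saddle _ _) prin_dist row_vander PstarE optE.
have [Xk|kX] := ltnP #|X| k; first by rewrite saddle_small// !mulr0.
have Xd : #|X| = (k + (#|X| - k))%N by rewrite subnKC.
rewrite -scalerA (saddle_scale _ _ yinj Xd) /flat_weight.
have -> : capped r #|X| = k by rewrite rk /=; apply/minn_idPr.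
by rewrite {1}Xd exprD -/c; ring.
Qed.

End Regimes.

Theorem theorem6p2 (R : realType) (n p : nat) (alpha : R) (x : 'I_n -> R)
    (kappa : R -> R -> R) (f : R -> R) (r : option nat)
    (P : R -> {set 'I_n} -> R)
    (alpha_gt0 : 0 < alpha)
    (x_inj : injective x)
    (kappa_pd : posdef_kernel kappa)
    (kappa_stat : stationary kappa f)
    (f_analytic : analytic_at0 f)
    (f_order : smoothness_order f r)
    (P_DPP : forall eps : R, 0 < eps ->
       is_DPP (P eps) ((alpha * eps ^- p) *: kernel_mx f x eps)) :
  exists Pstar : {set 'I_n} -> R,
    [/\ is_law Pstar,
        forall X : {set 'I_n}, P eps X @[eps --> 0^'+] --> Pstar X,
        n%:R <= p.+1%:R / 2 :> R -> Pstar [set: 'I_n]%SET = 1 &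
        p.+1%:R / 2 <= n%:R :> R ->
        [/\ (order_ereal r < (p.+1%:R / 2 : R)%:E)%E ->
              Pstar [set: 'I_n]%SET = 1,
            ((p.+1%:R / 2 : R)%:E < order_ereal r)%E ->
              (odd p -> let l := p.+1./2 in
                 is_fixed_size_DPP Pstar l (vander x l *m (vander x l)^T)) /\
              (~~ odd p -> let l := p./2 in
                 let w := invmx (wronskian kappa l) ord_max ord_max in
                 is_extended_DPP Pstar
                   ((alpha / w) *: (vcol x l.+1 *m (vcol x l.+1)^T))
                   (vander x l)) &
            forall k : nat, r = Some k -> k%:R = p.+1%:R / 2 :> R ->
              is_extended_DPP Pstar
                ((alpha * taylor_coef f (2 * k - 1)) *: dist_mx x (2 * k - 1))
                (vander x k)]].
Proof.
have [rho rho0 fser] := f_analytic.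
set c := taylor_coef f in fser *.
have cvgc : converges_within c rho.
  by move=> t /fser H; apply/cvg_ex; exists (f t).
have fE t : `|t| < rho -> f t = psum c t.
  by move=> /fser H; apply/esym/cvg_lim.
have [Pstar [K [law cv PstarE]]] := flat_limit x_inj kappa_pd kappa_stat
  f_order rho0 cvgc fE alpha_gt0 P_DPP.
exists Pstar; split=> //.
  rewrite ler_pdivlMr// -natrM ler_nat => np; apply: (full_limit law PstarE) => a an.
  by rewrite /exponent_step; case: (r) => [k|]; lia.
rewrite ler_pdivrMr// -natrM ler_nat => pn; split.
- move=> rp; apply: (full_limit law PstarE) => a an.
  case: (r) f_order rp => [k [k1 _ _]|//] /=.
  by rewrite lte_fin ltr_pdivlMr// -natrM ltr_nat; lia.
- move=> pr; have rE q : (2 * q <= p.+3)%N -> below_order r q.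
    case: (r) pr => [k|//] /=.
    by rewrite lte_fin ltr_pdivrMr// -natrM ltr_nat; lia.
  split=> [podd l|peven l].
    apply: (fixed_size_limit x_inj law PstarE).
    + by rewrite /l; lia.
    + by rewrite /l; lia.
    + by apply: rE; rewrite /l; lia.
  apply: (rank_one_limit x_inj law PstarE kappa_pd kappa_stat f_order rho0 cvgc fE alpha_gt0).
  + by rewrite /l; lia.
  + by rewrite /l; lia.
  + by apply: rE; rewrite /l; lia.
- move=> k rk kp.
  have pk : p.+1 = (2 * k)%N.
    by apply/eqP; rewrite -(eqr_nat R) natrM kp; apply/eqP; field.
  apply: (distance_limit x_inj law PstarE kappa_pd kappa_stat f_order rho0 cvgc fE alpha_gt0 rk); lia.
Qed.
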